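(* Let $\Gamma$ be a finitely generated group with sub-rapid decay (SRD). If $g\in\Gamma$ is an element such that $C_\Gamma(g)$ is not co-amenable in $\Gamma$, then $g$ acts topologically freely on every compact minimal $\Gamma$-space $\mathcal{X}$ with amenable neighborhood stabilizers. Moreover, if $C_\Gamma(g)$ is not co-amenable in $\Gamma$ for every non-trivial $g\in\Gamma$, then $\Gamma$ is $\mathrm{C}^*$-simple.
   Context: Fix a finite symmetric generating set of $\Gamma$; $B_n(\Gamma)$ is the ball of radius $n$ around the identity. Let $\lambda$ be the left regular representation of $\Gamma$ on $\ell^2(\Gamma)$, extended linearly to $\mathbb{C}\Gamma$. Define $$\rho(n)=\max\left\{\frac{\|\lambda(f)\|}{\|f\|_2}: 0\neq f\in\mathbb{C}\Gamma,\ \mathrm{supp}(f)\subseteq B_n(\Gamma)\right\}.$$ $\Gamma$ has SRD if $\rho(n)$ grows subexponentially, i.e. $\limsup_n\rho(n)^{1/n}\le1$. $C_\Gamma(g)$ is the centralizer of $g$. A subgroup $H\le\Gamma$ is co-amenable in $\Gamma$ if there is a $\Gamma$-invariant mean on $\ell^\infty(\Gamma/H)$. $\Gamma$ is $\mathrm{C}^*$-simple if its reduced C*-algebra $\mathrm{C}^*_r(\Gamma)$ is simple. A compact $\Gamma$-space is a compact Hausdorff space with an action of $\Gamma$ by homeomorphisms; it is minimal if every orbit is dense. The neighborhood stabilizer of $x\in\mathcal{X}$ is $\Gamma_x^o=\{h\in\Gamma: hy=y \text{ for all } y \text{ in some open neighborhood of } x\}$; $\mathcal{X}$ has amenable neighborhood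 stabilizers if $\Gamma_x^o$ is amenable for all $x\in\mathcal{X}$. An element $g$ acts topologically freely on $\mathcal{X}$ if $\mathrm{Fix}(g)=\{x\in\mathcal{X}: gx=x\}$ has empty interior. *)

(* Defs.v *)
From HB Require Import structures.
From mathcomp Require Import all_boot all_order all_algebra finmap.
From mathcomp Require Import all_classical all_reals all_analysis.
From mathcomp Require Import complex ring lra.

Set Implicit Arguments.
Unset Strict Implicit.
Unset Printing Implicit Defensive.

Import Order.TTheory GRing.Theory Num.Theory.
Import numFieldNormedType.Exports.
Import ComplexField.Normc.

Local Open Scope fset_scope.
Local Open Scope classical_set_scope.
Local Open Scope ring_scope.

(* A subgroup of [G] is a [groupClosed G], the library's structure of
   predicates closed under the group operations. *)
Section SubgroupType.
Variables (G : groupType) (H : groupClosed G).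

Record subgroup_type := SubgroupElt { sgval : G; sgvalP : sgval \in H }.

HB.instance Definition _ := [isSub for sgval].
HB.instance Definition _ := [Choice of subgroup_type by <:].

Lemma groupClosed_closed : group_closed H.
Proof. by split=> [|x y xH yH]; [exact: gpred1 | exact: gpredF]. Qed.

HB.instance Definition _ :=
  SubChoice_isSubGroup.Build G (mem H) subgroup_type groupClosed_closed.

End SubgroupType.

Definition centralizer (G : groupType) (g : G) : {pred G} :=
  fun h => (h * g == g * h)%g.

Section CentralizerSubgroup.
Variables (G : groupType) (g : G).

Lemma centralizer1 : 1%g \in centralizer g.
Proof. by rewrite unfold_in /centralizer mul1g mulg1. Qed.

Lemma centralizerM : mulg_closed (centralizer g).
Proof.
move=> x y /eqP xg /eqP yg; apply/eqP.
by rewrite -mulgA yg mulgA xg mulgA.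
Qed.

Lemma centralizerV : invg_closed (centralizer g).
Proof.
move=> x /eqP xg; apply/eqP.
by rewrite -{1}[g](mulgK x) -xg !mulgA mulVg mul1g.
Qed.

HB.instance Definition _ := isMulClosed.Build G (centralizer g) centralizerM.
HB.instance Definition _ := isMul1Closed.Build G (centralizer g) centralizer1.
HB.instance Definition _ := isInvClosed.Build G (centralizer g) centralizerV.

End CentralizerSubgroup.

Definition symmetric_subset (G : groupType) (S : {fset G}) :=
  forall s, s \in S -> (s^-1)%g \in S.

Definition generates (G : groupType) (S : {fset G}) :=
  forall H : groupClosed G, {subset S <= H} -> forall g, g \in H.

Definition word_ball (G : groupType) (S : {fset G}) (n : nat) : set G :=
  [set g | exists w : seq G,
     [/\ (size w <= n)%N, {subset w <= S} & g = (\prod_(s <- w) s)%g]].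

Record is_mean (R : realType) (X : Type) (m : (X -> R) -> R) : Prop := {
  mean_linear : forall (a : R) (p q : X -> R),
    bounded_fun (p : X -> R^o) -> bounded_fun (q : X -> R^o) ->
    m (fun x => a * p x + q x) = a * m p + m q;
  mean_ge0 : forall p : X -> R,
    bounded_fun (p : X -> R^o) -> (forall x, 0 <= p x) -> 0 <= m p;
  mean1 : m (fun=> 1) = 1
}.

(* A mean on l^oo(X) is a total function whose values off the bounded
   functions are irrelevant. *)
Definition has_invariant_mean (R : realType) (G : groupType) (X : Type)
    (act : G -> X -> X) :=
  exists m : (X -> R) -> R, is_mean m /\
    forall (g : G) (p : X -> R), bounded_fun (p : X -> R^o) ->
      m (p \o act g) = m p.

Definition amenable (R : realType) (G : groupType) :=
  has_invariant_mean R (fun g x : G => (g * x)%g).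

Definition lcoset_set (G : groupType) (H : groupClosed G) (g : G) : set G :=
  [set (g * h)%g | h in [set` H]].

Definition coset_space (G : groupType) (H : groupClosed G) : Type :=
  {A : set G | exists g, A = lcoset_set H g}.

Lemma coset_act_subproof (G : groupType) (H : groupClosed G) (g : G)
    (A : coset_space H) :
  exists k, [set (g * a)%g | a in sval A] = lcoset_set H k.
Proof.
case: A => A [k Ak]; exists (g * k)%g => /=; rewrite Ak /lcoset_set.
rewrite image_comp; apply: eq_imagel => h _ /=; exact: mulgA.
Qed.

Definition coset_act (G : groupType) (H : groupClosed G) (g : G)
    (A : coset_space H) : coset_space H :=
  exist _ _ (coset_act_subproof g A).

Definition coamenable (R : realType) (G : groupType) (H : groupClosed G) :=
  has_invariant_mean R (@coset_act G H).

Section Ell2.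
Variables (R : realType) (G : groupType).
Local Notation C := R[i].

Definition l2norm (u : G -> C) : \bar R :=
  ((\esum_(x in [set: G]) (normc (u x) ^+ 2)%:E) `^ 2^-1)%E.

Definition square_summable : {pred G -> C} :=
  fun u => `[< (l2norm u < +oo)%E >].

Lemma l2norm_ltyE (u : G -> C) :
  (l2norm u < +oo)%E <->
  (\esum_(x in [set: G]) (normc (u x) ^+ 2)%:E < +oo)%E.
Proof.
split; last exact: poweR_lty.
by apply: lty_poweRy; rewrite invr_eq0 pnatr_eq0.
Qed.

Lemma normc_ge0 (z : C) : 0 <= normc z.
Proof. by case: z => a b; exact: sqrtr_ge0. Qed.

Lemma esumZ_le (r : R) (p : G -> \bar R) :
  0 <= r -> (forall x, 0 <= p x)%E ->
  (\esum_(x in [set: G]) (r%:E * p x) <= r%:E * \esum_(x in [set: G]) p x)%E.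
Proof.
move=> r0 p0; apply: ge_ereal_sup => _ [X [finX _] <-].
rewrite -ge0_mule_fsumr //; apply: lee_wpmul2l; first by rewrite lee_fin.
by apply: esum_ge; exists X.
Qed.

Lemma square_summable_submod : submod_closed square_summable.
Proof.
split.
  apply/asboolP/l2norm_ltyE.
  rewrite (eq_esum (b := fun=> 0%E)) ?esum1 ?ltry//= => x _.
  by rewrite !expr0n/= addr0 sqrtr0 expr0n.
move=> a u v /asboolP/l2norm_ltyE su /asboolP/l2norm_ltyE sv.
apply/asboolP/l2norm_ltyE.
pose U x := ((normc (u x) ^+ 2)%:E : \bar R).
pose V x := ((normc (v x) ^+ 2)%:E : \bar R).
have U0 x : (0 <= U x)%E by rewrite lee_fin sqr_ge0.
have V0 x : (0 <= V x)%E by rewrite lee_fin sqr_ge0.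
pose r := 2 * normc a ^+ 2.
have r0 : 0 <= r by rewrite mulr_ge0 ?sqr_ge0.
have bound x : ((normc ((a *: u + v) x) ^+ 2)%:E <=
    r%:E * U x + 2%:E * V x)%E.
  rewrite -!EFinM -EFinD lee_fin.
  have := le_normcD (a *: u x) (v x).
  have -> : (a *: u + v) x = a *: u x + v x by [].
  rewrite normcM => le1.
  apply: (@le_trans _ _ ((normc a * normc (u x) + normc (v x)) ^+ 2)).
    by rewrite lerXn2r ?nnegrE ?addr_ge0 ?mulr_ge0 ?normc_ge0.
  have := sqr_ge0 (normc a * normc (u x) - normc (v x)).
  rewrite /r; nra.
apply: (le_lt_trans (le_esum (fun x _ => bound x))).
rewrite esumD => [|x _|x _]; try by rewrite mule_ge0 // lee_fin.
apply: lte_add_pinfty.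
  apply: (le_lt_trans (esumZ_le r0 U0)).
  by rewrite lte_mul_pinfty ?lee_fin.
apply: (le_lt_trans (esumZ_le _ V0)); first by [].
by rewrite lte_mul_pinfty ?lee_fin.
Qed.

HB.instance Definition _ :=
  GRing.isSubmodClosed.Build C (G -> C) square_summable square_summable_submod.

Record ell2 := Ell2 { ell2_fun :> G -> C; ell2P : ell2_fun \in square_summable }.

HB.instance Definition _ := [isSub for ell2_fun].
HB.instance Definition _ := [Choice of ell2 by <:].
HB.instance Definition _ := [SubChoice_isSubLmodule of ell2 by <:].

End Ell2.

Section RegularRepresentation.
Variables (R : realType) (G : groupType).
Local Notation C := R[i].

Lemma translate_square_summable (g : G) (u : ell2 R G) :
  (fun x => u (g^-1 * x)%g) \in @square_summable R G.
Proof.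
apply/asboolP/l2norm_ltyE; have /asboolP/l2norm_ltyE := ell2P u.
rewrite (@reindex_esum _ _ _ [set: G] _ (fun x => (g^-1 * x)%g)) //.
split=> // [x y _ _ /mulgI//|y _]; exists (g * y)%g => //.
exact: mulKg.
Qed.

Definition regular (g : G) (u : ell2 R G) : ell2 R G :=
  Ell2 (translate_square_summable g u).

(* Only the underlying set of the group ring is used, so that a finitely
   supported function is enough. *)
Definition group_algebra := {fsfun G -> C with 0}.

Definition regular_alg (f : group_algebra) (u : ell2 R G) : ell2 R G :=
  \sum_(g <- finsupp f) f g *: regular g u.

Definition opnorm (T : ell2 R G -> ell2 R G) : \bar R :=
  ereal_sup [set l2norm (T u) | u in [set u : ell2 R G | (l2norm u <= 1)%E]].

Definition bounded_operator (T : ell2 R G -> ell2 R G) : Prop :=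
  linear T /\ (opnorm T < +oo)%E.

(* For finite [word_ball S n] the [f] below range, up to scaling, over the unit
   sphere of a finite-dimensional space, so the supremum is a maximum. *)
Definition decay_fun (S : {fset G}) (n : nat) : \bar R :=
  ereal_sup [set (opnorm (regular_alg f) / l2norm f)%E |
    f in [set f : group_algebra |
      finsupp f != fset0 /\ [set` finsupp f] `<=` word_ball S n]].

Definition sub_rapid_decay (S : {fset G}) : Prop :=
  (limn_esup (fun n => decay_fun S n `^ (n%:R^-1)) <= 1)%E.

(* The operator-norm closure of the image of the group ring in B(l^2(G)). *)
Definition reduced_cstar : set (ell2 R G -> ell2 R G) :=
  [set T | bounded_operator T /\
    forall e : R, 0 < e ->
      exists f : group_algebra, (opnorm (T - regular_alg f)%R < e%:E)%E].

(* Norm-closed two-sided ideals of [reduced_cstar]; the sum and scaling of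
   operators are pointwise and the product is composition. *)
Record closed_ideal (J : set (ell2 R G -> ell2 R G)) : Prop := {
  ideal_sub : J `<=` reduced_cstar;
  ideal0 : J 0;
  idealD : forall T U, J T -> J U -> J (T + U);
  idealZ : forall (a : C) T, J T -> J (a *: T);
  idealMl : forall T U, reduced_cstar T -> J U -> J (T \o U);
  idealMr : forall T U, J T -> reduced_cstar U -> J (T \o U);
  ideal_closed : forall T, reduced_cstar T ->
    (forall e : R, 0 < e ->
      exists2 U, J U & (opnorm (T - U)%R < e%:E)%E) -> J T
}.

Definition cstar_simple : Prop :=
  forall J, closed_ideal J -> J = [set 0] \/ J = reduced_cstar.

End RegularRepresentation.

(* Each [gact g] is a homeomorphism since its inverse [gact g^-1] is also
   continuous. *)
Record compact_gspace (G : groupType) := CompactGSpace {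
  gspace_sort :> topologicalType;
  gact : G -> gspace_sort -> gspace_sort;
  gact1 : forall x, gact 1%g x = x;
  gactM : forall g h x, gact (g * h)%g x = gact g (gact h x);
  gact_continuous : forall g, continuous (gact g);
  gspace_compact : compact [set: gspace_sort];
  gspace_hausdorff : hausdorff_space gspace_sort
}.

Arguments gact {G} X g x : rename.

Section CompactGSpaces.
Variables (G : groupType) (X : compact_gspace G).

Definition minimal : Prop :=
  forall x : X, dense [set gact X g x | g in [set: G]].

Definition topologically_free (g : G) : Prop :=
  interior [set x : X | gact X g x = x] = set0.

Definition nbhd_stabilizer (x : X) : {pred G} :=
  fun h => `[< exists2 U : set X, open_nbhs x U &
                 forall y, U y -> gact X h y = y >].

Lemma nbhd_stabilizer1 (x : X) : 1%g \in nbhd_stabilizer x.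
Proof.
apply/asboolP; exists setT => [|y _]; last exact: gact1.
by split=> //; exact: openT.
Qed.

Lemma nbhd_stabilizerM (x : X) : mulg_closed (nbhd_stabilizer x).
Proof.
move=> g h /asboolP[U [oU Ux] gU] /asboolP[V [oV Vx] hV].
apply/asboolP; exists (U `&` V); first by split; [exact: openI | split].
by move=> y [Uy Vy]; rewrite gactM hV // gU.
Qed.

Lemma nbhd_stabilizerV (x : X) : invg_closed (nbhd_stabilizer x).
Proof.
move=> g /asboolP[U xU gU]; apply/asboolP; exists U => // y Uy.
by rewrite -{1}(gU _ Uy) -gactM mulVg gact1.
Qed.

HB.instance Definition _ (x : X) :=
  isMulClosed.Build G (nbhd_stabilizer x) (@nbhd_stabilizerM x).
HB.instance Definition _ (x : X) :=
  isMul1Closed.Build G (nbhd_stabilizer x) (nbhd_stabilizer1 x).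
HB.instance Definition _ (x : X) :=
  isInvClosed.Build G (nbhd_stabilizer x) (@nbhd_stabilizerV x).

Definition amenable_nbhd_stabilizers (R : realType) : Prop :=
  forall x : X, amenable R (subgroup_type (nbhd_stabilizer x)).

End CompactGSpaces.

(* Main.v *)
From HB Require Import structures.
Require Import Defs.
From mathcomp Require Import all_boot all_order all_algebra finmap.
From mathcomp Require Import all_classical all_reals all_analysis.
From mathcomp Require Import complex ring lra zify.

(** Put S1 = S with the identity added, k = #|S1|, and let P be the operator
    that averages a function on the group over conjugation by S1. Starting at
    the point mass at g, P produces finitely supported probabilities
    F_n = P^n delta_g (here [walk g n]), carried by the conjugates of g and by
    the ball of radius 2n + |g|. If no c < 1 satisfies
    |F_(n+1)|^2 <= c |F_n|^2 for all n, then some of the F_n are almost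
    P-isometric, hence almost invariant because the variance of an average
    measures its loss of norm; a limit of the densities F_n^2 along an
    ultrafilter is then an invariant mean on the conjugacy class of g, which is
    the coset space of the centralizer. So if the centralizer is not
    co-amenable, |F_n| decays exponentially ([walk_decay]), and sub-rapid decay
    turns this into lambda(F_n) -> 0 in operator norm ([srd_decay]).

    C*-simplicity. lambda(F_n) is the n-th iterated average of the conjugates
    of lambda(g), and the averaging set S1 is the same for every g. Hence
    averaging sends every lambda(f) to f(1) in the limit. A nonzero closed
    ideal contains an operator a with <a delta_1, delta_1> = 1; its averages
    stay in the ideal and approach the identity ([srd_cstar_simple]).

    Topological freeness. If g fixes a nonempty open set U pointwise, a
    conjugate x g x^-1 lies in the neighborhood stabilizer of each point of
    x U. By minimality and compactness finitely many translates of U cover the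
    space, and therefore F_n gives every neighborhood stabilizer a mass that is
    bounded below for all large n ([stab_mass_bound]). On the other hand
    the mass that a nonnegative symmetric f gives to an amenable subgroup is at
    most the norm of lambda(f) ([amenable_sum_le], the easy half of Kesten's
    criterion). Applied to a symmetrization of F_n, whose operator norm still
    tends to 0, this is a contradiction.

    Kesten's inequality is obtained from the invariant mean m itself, with no
    Folner or Reiter sequence. For r larger than the norm of lambda(f), the
    Green function psi = sum_n r^-n lambda(f)^n delta_1 solves
    lambda(f) psi <= r psi, and is positive if f charges the generators. On the subgroup, t |-> m(ln psi(t^-1 .) - ln psi)
    changes sign under t |-> t^-1, so its sum against f vanishes; but concavity
    of ln makes that sum negative once the mass of f exceeds r. *)

Set Implicit Arguments.
Unset Strict Implicit.
Unset Printing Implicit Defensive.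

Import Order.TTheory GRing.Theory Num.Theory.
Import numFieldNormedType.Exports.
Import ComplexField.Normc.

Local Open Scope fset_scope.
Local Open Scope classical_set_scope.
Local Open Scope ring_scope.

(** * Sums of finitely supported functions *)

Section FiniteSums.
Variables (R : realType) (T : choiceType).
Implicit Types (A : {fset T}) (phi psi : T -> R).

Definition supported A phi := forall x, x \notin A -> phi x = 0.

(** [total] sums over [finite_support], so it is additive only on functions
    that satisfy this. *)
Definition finsupported phi := exists A, supported A phi.

Definition total phi : R := \sum_(x \in [set: T]) phi x.

Lemma totalE A phi : supported A phi -> total phi = \sum_(x <- A) phi x.
Proof.
move=> phiA; rewrite /total (@fsbigTE _ _ _ _ A) // => x /phiA.
Qed.

Lemma supportedU A B phi : supported A phi -> supported (A `|` B)%fset phi.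
Proof. by move=> phiA x; rewrite inE negb_or => /andP[/phiA]. Qed.

Lemma supportedUr A B phi : supported B phi -> supported (A `|` B)%fset phi.
Proof. by move=> phiB x; rewrite inE negb_or => /andP[_ /phiB]. Qed.

Lemma finsupportedD phi psi : finsupported phi -> finsupported psi ->
  finsupported (fun x => phi x + psi x).
Proof.
move=> [A phiA] [B psiB]; exists (A `|` B)%fset => x xAB.
by rewrite (supportedU (B := B) phiA) // (supportedUr (A := A) psiB) // addr0.
Qed.

Lemma finsupportedM phi psi : finsupported phi ->
  finsupported (fun x => phi x * psi x).
Proof. by move=> [A phiA]; exists A => x /phiA ->; rewrite mul0r. Qed.

Lemma finsupported_comp phi (f : R -> R) : f 0 = 0 -> finsupported phi ->
  finsupported (f \o phi).
Proof. by move=> f0 [A phiA]; exists A => x /phiA /= ->. Qed.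

Lemma totalD phi psi : finsupported phi -> finsupported psi ->
  total (fun x => phi x + psi x) = total phi + total psi.
Proof.
move=> [A phiA] [B psiB]; rewrite (totalE (supportedU (B := B) phiA)).
rewrite (totalE (supportedUr (A := A) psiB)) -big_split; apply: totalE => x xAB.
by rewrite (supportedU (B := B) phiA) // (supportedUr (A := A) psiB) // addr0.
Qed.

Lemma totalZ a phi : finsupported phi ->
  total (fun x => a * phi x) = a * total phi.
Proof.
move=> [A phiA]; rewrite (totalE phiA) mulr_sumr; apply: totalE => x /phiA ->.
by rewrite mulr0.
Qed.

Lemma finsupported_sum (I : Type) (r : seq I) (phi : I -> T -> R) :
  (forall i, finsupported (phi i)) ->
  finsupported (fun x => \sum_(i <- r) phi i x).
Proof.
move=> fphi; elim: r => [|i r IH]; first by exists fset0%fset => x _; rewrite big_nil.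
have [A HA] := finsupportedD (fphi i) IH; exists A => x /HA.
by rewrite big_cons.
Qed.

Lemma total_sum (I : Type) (r : seq I) (phi : I -> T -> R) :
  (forall i, finsupported (phi i)) ->
  total (fun x => \sum_(i <- r) phi i x) = \sum_(i <- r) total (phi i).
Proof.
move=> fphi; elim: r => [|i r IH].
  rewrite big_nil (@totalE fset0%fset) ?big_nil // => x _; exact: big_nil.
rewrite big_cons -IH -totalD //; last exact: finsupported_sum.
by congr total; apply/funext => x; rewrite big_cons.
Qed.

Lemma total_reindex (h : T -> T) phi : bijective h ->
  total (fun x => phi (h x)) = total phi.
Proof.
move=> hbij; rewrite /total [RHS](reindex_fsbigT h) //.
Qed.

Lemma ler_total phi psi : finsupported phi -> finsupported psi ->
  (forall x, phi x <= psi x) -> total phi <= total psi.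
Proof.
move=> [A phiA] [B psiB] le; rewrite (totalE (supportedU (B := B) phiA)).
by rewrite (totalE (supportedUr (A := A) psiB)); apply: ler_sum.
Qed.

Lemma total_ge0 phi : (forall x, 0 <= phi x) -> 0 <= total phi.
Proof. by move=> phi0; rewrite /total fsumr_ge0. Qed.

Lemma ler_total1 phi y : finsupported phi -> (forall x, 0 <= phi x) ->
  phi y <= total phi.
Proof.
move=> [A phiA] phi0; rewrite (totalE (supportedU (B := [fset y]) phiA)).
rewrite (big_fsetD1 y) /= ?lerDl ?sumr_ge0 //.
by rewrite !inE eqxx orbT.
Qed.

End FiniteSums.

(** * Averaging over conjugation by a finite set *)

Section ConjugationAverage.
Variables (R : realType) (G : groupType) (S : {fset G}).
Hypothesis S1 : 1%g \in S.
Implicit Types (phi psi : G -> R).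

Local Notation k := (#|` S|%:R : R).

Lemma bijective_conj (s : G) : bijective (fun x : G => (x ^ s)%g).
Proof. by exists (fun x => (x ^ s^-1)%g) => x /=; rewrite ?conjgK ?conjgKV. Qed.

Lemma finsupported_conj phi (s : G) : finsupported phi ->
  finsupported (fun x => phi (x ^ s)%g).
Proof.
move=> [A phiA]; exists [fset (x ^ s^-1)%g | x in A] => x xA.
apply: phiA; apply: contra xA => xA.
by apply/imfsetP; exists (x ^ s)%g => //=; rewrite conjgK.
Qed.

Lemma total_conj phi (s : G) : total (fun x => phi (x ^ s)%g) = total phi.
Proof. exact: total_reindex (bijective_conj s). Qed.

Lemma sumr_const_fset (c : R) : \sum_(s <- S) c = k * c.
Proof. by rewrite big_const_seq count_predT iter_addr_0 mulr_natl. Qed.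

Definition conj_avg phi : G -> R := fun x => k^-1 * \sum_(s <- S) phi (x ^ s)%g.

Lemma card_gt0 : 0 < k.
Proof. by rewrite ltr0n cardfs_gt0; apply/fset0Pn; exists 1%g. Qed.

Lemma finsupported_avg phi : finsupported phi -> finsupported (conj_avg phi).
Proof.
move=> fphi; apply: (@finsupported_comp _ _ _ (fun z : R => k^-1 * z)).
  by rewrite mulr0.
by apply: finsupported_sum => s; exact: finsupported_conj.
Qed.

Lemma conj_avg_ge0 phi : (forall x, 0 <= phi x) -> forall x, 0 <= conj_avg phi x.
Proof.
by move=> phi0 x; rewrite mulr_ge0 ?invr_ge0 ?ler0n// sumr_ge0.
Qed.

Lemma total_avg phi : finsupported phi -> total (conj_avg phi) = total phi.
Proof.
move=> fphi; rewrite totalZ; last first.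
  by apply: finsupported_sum => s; exact: finsupported_conj.
rewrite total_sum; last by move=> s; exact: finsupported_conj.
rewrite (eq_bigr (fun=> total phi)); last by move=> s _; exact: total_conj.
rewrite sumr_const_fset mulrA mulVf ?mul1r//.
exact: lt0r_neq0 card_gt0.
Qed.

(** Conjugation preserves [total], so this is the mean of squares minus the
    square of the mean, summed over the group. *)
Lemma conj_avg_variance phi : finsupported phi ->
  \sum_(s <- S) total (fun x => (phi (x ^ s)%g - conj_avg phi x) ^+ 2) =
  k * (total (fun x => phi x ^+ 2) - total (fun x => conj_avg phi x ^+ 2)).
Proof.
move=> fphi; have k0 := lt0r_neq0 card_gt0.
have fsq psi : finsupported psi -> finsupported (fun x => psi x ^+ 2).
  by move=> fpsi; apply: (@finsupported_comp _ _ _ (fun z : R => z ^+ 2));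
    rewrite ?expr0n.
have fN psi : finsupported psi -> finsupported (fun x => - psi x).
  by move=> fpsi; apply: (@finsupported_comp _ _ _ (fun z : R => - z));
    rewrite ?oppr0.
rewrite -total_sum; last first.
  move=> s; apply: fsq; apply: finsupportedD; first exact: finsupported_conj.
  exact/fN/finsupported_avg.
have -> : (fun x => \sum_(s <- S) (phi (x ^ s)%g - conj_avg phi x) ^+ 2) =
    (fun x => \sum_(s <- S) (phi (x ^ s)%g) ^+ 2 + (- k) * conj_avg phi x ^+ 2).
  apply/funext => x; rewrite (eq_bigr (fun s => phi (x ^ s)%g ^+ 2 +
    ((- (2 * conj_avg phi x)) * phi (x ^ s)%g + conj_avg phi x ^+ 2)));
    last by move=> s _; ring.
  rewrite !big_split/= -mulr_sumr sumr_const_fset.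
  have -> : \sum_(s <- S) phi (x ^ s)%g = k * conj_avg phi x.
    by rewrite mulrA mulfV// mul1r.
  by congr (_ + _); rewrite /=; ring.
have fs s : finsupported (fun x => phi (x ^ s)%g ^+ 2).
  exact/fsq/finsupported_conj.
have fa : finsupported (fun x => conj_avg phi x ^+ 2).
  exact/fsq/finsupported_avg.
rewrite totalD; last 2 first.
- exact: finsupported_sum.
- apply: (@finsupported_comp _ _ _ (fun z : R => - k * z)) => //.
  by rewrite mulr0.
rewrite total_sum// totalZ// (eq_bigr (fun=> total (fun x => phi x ^+ 2))).
  by rewrite sumr_const_fset; ring.
by move=> s _; exact: (total_conj (fun x => phi x ^+ 2)).
Qed.

(** A small loss of norm bounds every term of the variance; since 1 is in [S],
    the function itself and its conjugate by [s] are then both close to the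
    average, hence close to each other. *)
Lemma conj_avg_almost_invariant phi (e : R) s : finsupported phi -> s \in S ->
  (1 - e) * total (fun x => phi x ^+ 2) <=
    total (fun x => conj_avg phi x ^+ 2) ->
  total (fun x => (phi (x ^ s)%g - phi x) ^+ 2) <=
    4 * k * e * total (fun x => phi x ^+ 2).
Proof.
move=> fphi sS le; have var := conj_avg_variance fphi.
pose d t := total (fun x => (phi (x ^ t)%g - conj_avg phi x) ^+ 2).
have d0 t : 0 <= d t by apply: total_ge0 => x; exact: sqr_ge0.
have dle t : t \in S -> d t <= k * e * total (fun x => phi x ^+ 2).
  move=> tS; have : d t <= \sum_(s <- S) d s.
    by rewrite (big_fsetD1 t)//= lerDl sumr_ge0.
  rewrite var => /le_trans; apply; rewrite -mulrA ler_wpM2l ?ler0n//; lra.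
have fd t : finsupported (fun x => (phi (x ^ t)%g - conj_avg phi x) ^+ 2).
  apply: (@finsupported_comp _ _ _ (fun z : R => z ^+ 2)); rewrite ?expr0n//.
  apply: finsupportedD; first exact: finsupported_conj.
  apply: (@finsupported_comp _ _ _ (fun z : R => - z)); rewrite ?oppr0//.
  exact: finsupported_avg.
have f2 t : finsupported (fun x => 2 * (phi (x ^ t)%g - conj_avg phi x) ^+ 2).
  by apply: (@finsupported_comp _ _ _ (fun z : R => 2 * z)); rewrite ?mulr0.
have : total (fun x => (phi (x ^ s)%g - phi x) ^+ 2) <=
    total (fun x => 2 * (phi (x ^ s)%g - conj_avg phi x) ^+ 2 +
                    2 * (phi (x ^ 1)%g - conj_avg phi x) ^+ 2).
  apply: ler_total; last 2 first.
  - exact: finsupportedD.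
  - by move=> x; rewrite conjg1;
      have := sqr_ge0 (phi (x ^ s)%g - 2 * conj_avg phi x + phi x); nra.
  apply: (@finsupported_comp _ _ _ (fun z : R => z ^+ 2)); rewrite ?expr0n//.
  apply: finsupportedD; first exact: finsupported_conj.
  by apply: (@finsupported_comp _ _ _ (fun z : R => - z)); rewrite ?oppr0.
rewrite totalD ?totalZ// -/(d s) -/(d 1%g) => /le_trans; apply.
have := dle _ sS; have := dle _ S1; nra.
Qed.

(** Almost invariance passes from [phi] in l^2 to the density [phi ^+ 2] in l^1:
    a^2 - b^2 = (a - b)(a + b), and the weighted inequality
    |uv| <= u^2 / (2e) + e v^2 / 2 stands in for Cauchy-Schwarz. *)
Lemma sq_almost_invariant phi (e M : R) s (p : G -> R) :
  finsupported phi -> s \in S -> 0 < e ->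
  (forall x, `|p x| <= M) ->
  (1 - e ^+ 2) * total (fun x => phi x ^+ 2) <=
    total (fun x => conj_avg phi x ^+ 2) ->
  `|total (fun x => phi (x ^ s)%g ^+ 2 * p x) - total (fun x => phi x ^+ 2 * p x)|
    <= M * (2 * k + 2) * e * total (fun x => phi x ^+ 2).
Proof.
move=> fphi sS e0 pM /(conj_avg_almost_invariant fphi sS).
set a := total (fun x => phi x ^+ 2) => le.
have M0 : 0 <= M := le_trans (normr_ge0 _) (pM 1%g).
have fsq psi : finsupported psi -> finsupported (fun x => psi x ^+ 2).
  by move=> fpsi; apply: (@finsupported_comp _ _ _ (fun z : R => z ^+ 2));
    rewrite ?expr0n.
have fZ c psi : finsupported psi -> finsupported (fun x => c * psi x).
  by move=> fpsi; apply: (@finsupported_comp _ _ _ (fun z : R => c * z));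
    rewrite ?mulr0.
have fs := finsupported_conj s fphi.
have fdiff : finsupported (fun x => (phi (x ^ s)%g - phi x) ^+ 2).
  apply/fsq/finsupportedD => //.
  by apply: (@finsupported_comp _ _ _ (fun z : R => - z)); rewrite ?oppr0.
have -> : total (fun x => phi (x ^ s)%g ^+ 2 * p x) -
     total (fun x => phi x ^+ 2 * p x) =
    total (fun x => phi (x ^ s)%g ^+ 2 * p x + (-1) * (phi x ^+ 2 * p x)).
  rewrite totalD ?totalZ ?mulN1r//; try exact/finsupportedM/fsq.
  exact/fZ/finsupportedM/fsq.
pose b x := M * (2 * e)^-1 * (phi (x ^ s)%g - phi x) ^+ 2 +
  (M * e * phi (x ^ s)%g ^+ 2 + M * e * phi x ^+ 2).
have fb : finsupported b.
  by apply: finsupportedD; [exact: fZ | apply: finsupportedD; exact/fZ/fsq].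
have tb : total b <= M * (2 * k + 2) * e * a.
  rewrite totalD ?totalD ?totalZ//; try by [exact/fZ/fsq | exact/fsq | exact/fZ];
   last by apply: finsupportedD; exact/fZ/fsq.
  rewrite (total_conj (fun x => phi x ^+ 2)) -/a.
  have : M * (2 * e)^-1 * total (fun x => (phi (x ^ s)%g - phi x) ^+ 2) <=
     M * (2 * e)^-1 * (4 * k * e ^+ 2 * a).
    by rewrite ler_wpM2l// mulr_ge0// invr_ge0 mulr_ge0// ltW.
  have -> : M * (2 * e)^-1 * (4 * k * e ^+ 2 * a) = M * (2 * k * e * a).
    by field; exact: lt0r_neq0.
  set D := M * _ * total _ => leD; lra.
have pw x : `|phi (x ^ s)%g ^+ 2 * p x + (-1) * (phi x ^+ 2 * p x)| <= b x.
  have -> : phi (x ^ s)%g ^+ 2 * p x + (-1) * (phi x ^+ 2 * p x) =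
     ((phi (x ^ s)%g - phi x) * (phi (x ^ s)%g + phi x)) * p x by ring.
  rewrite normrM mulrC.
  apply: (le_trans (ler_wpM2r (normr_ge0 _) (pM x))).
  rewrite /b -!mulrA -!mulrDr ler_wpM2l// normrM.
  set u := `|_|; set v := `|_|.
  have -> : (phi (x ^ s)%g - phi x) ^+ 2 = u ^+ 2 by rewrite real_normK ?num_real.
  have v2 : v ^+ 2 = (phi (x ^ s)%g + phi x) ^+ 2.
    by rewrite real_normK ?num_real.
  have -> : e * (phi (x ^ s)%g ^+ 2 + phi x ^+ 2) =
     2^-1 * e * (u ^+ 2 + v ^+ 2).
    by rewrite v2 /u real_normK ?num_real//; field.
  have -> : u * v = (2 * e)^-1 * (2 * (e * u * v)).
    by field; exact: lt0r_neq0.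
  have -> : 2^-1 * e * (u ^+ 2 + v ^+ 2) =
     (2 * e)^-1 * (e ^+ 2 * (u ^+ 2 + v ^+ 2)).
    by field; exact: lt0r_neq0.
  rewrite -mulrDr ler_wpM2l ?invr_ge0 ?mulr_ge0 ?(ltW e0)//.
  have := sqr_ge0 (u - e * v); have := sqr_ge0 (e * u); nra.
rewrite ler_norml; apply/andP; split.
  rewrite lerNl; apply: le_trans tb; rewrite -[- total _]mulN1r -totalZ; last first.
    apply: finsupportedD; first exact/finsupportedM/fsq.
    exact/fZ/finsupportedM/fsq.
  apply: ler_total => //.
    apply: (fZ (-1)); apply: finsupportedD; first exact/finsupportedM/fsq.
    exact/fZ/finsupportedM/fsq.
  by move=> x; have := pw x; rewrite ler_norml => /andP[+ _]; lra.
apply: le_trans tb; apply: ler_total => //.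
  apply: finsupportedD; first exact/finsupportedM/fsq.
  exact/fZ/finsupportedM/fsq.
by move=> x; apply: le_trans (pw x); exact: ler_norm.
Qed.

End ConjugationAverage.

(** * Word balls *)

Section WordBalls.
Variables (G : groupType) (S : {fset G}).

Lemma word_ball1 n : word_ball S n 1%g.
Proof. by exists [::]; split=> //; rewrite big_nil. Qed.

Lemma word_ball_mono m n x : (m <= n)%N -> word_ball S m x -> word_ball S n x.
Proof. by move=> mn [w [wm wS ->]]; exists w; split=> //; exact: leq_trans mn. Qed.

Lemma word_ballM m n x y :
  word_ball S m x -> word_ball S n y -> word_ball S (m + n) (x * y)%g.
Proof.
move=> [v [vm vS ->]] [w [wn wS ->]]; exists (v ++ w); split.
- by rewrite size_cat leq_add.
- by move=> z; rewrite mem_cat => /orP[/vS|/wS].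
- by rewrite big_cat.
Qed.

Lemma word_ball_gen s : s \in S -> word_ball S 1 s.
Proof.
move=> sS; exists [:: s]; split=> //; last by rewrite big_seq1.
by move=> z; rewrite inE => /eqP ->.
Qed.

Hypothesis Ssym : symmetric_subset S.

Lemma word_ballV n x : word_ball S n x -> word_ball S n (x^-1)%g.
Proof.
move=> [w [wn wS ->]]; exists (rev [seq (z^-1)%g | z <- w]); split.
- by rewrite size_rev size_map.
- by move=> z; rewrite mem_rev => /mapP[y /wS yS ->]; exact: Ssym.
elim: w {wn wS} => [|y w IH]; first by rewrite !big_nil invg1.
by rewrite big_cons invgM /= rev_cons -cats1 big_cat big_seq1 /= IH.
Qed.

(** Membership in some ball, made a subgroup so that [generates] applies to
    it. *)
Definition word_span : {pred G} := fun x => `[< exists n, word_ball S n x >].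

Lemma word_span1 : 1%g \in word_span.
Proof. by apply/asboolP; exists 0; exact: word_ball1. Qed.

Lemma word_spanM : mulg_closed word_span.
Proof.
move=> x y /asboolP[m xm] /asboolP[n yn]; apply/asboolP; exists (m + n)%N.
exact: word_ballM.
Qed.

Lemma word_spanV : invg_closed word_span.
Proof.
move=> x /asboolP[n xn]; apply/asboolP; exists n; exact: word_ballV.
Qed.

HB.instance Definition _ := isMulClosed.Build G word_span word_spanM.
HB.instance Definition _ := isMul1Closed.Build G word_span word_span1.
HB.instance Definition _ := isInvClosed.Build G word_span word_spanV.

Hypothesis Sgen : generates S.

Lemma word_ball_exhausts x : exists n, word_ball S n x.
Proof.
apply/asboolP; suff: x \in word_span by [].
apply: Sgen => s sS; apply/asboolP; exists 1; exact: word_ball_gen.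
Qed.

Lemma generates_ind (P : G -> Prop) : P 1%g ->
  (forall s x, s \in S -> P x -> P (s * x)%g) -> forall x, P x.
Proof.
move=> P1 PM x; have [_ [w [_ wS ->]]] := word_ball_exhausts x.
elim: w wS => [|s w IH] wS; first by rewrite big_nil.
rewrite big_cons; apply: PM; first by apply: wS; rewrite mem_head.
by apply: IH => z zw; apply: wS; rewrite in_cons zw orbT.
Qed.

End WordBalls.

(** * Means *)

Section Means.
Variables (R : realType) (X : Type).
Implicit Types (p q : X -> R) (m : (X -> R) -> R).

Lemma bounded_funE p :
  bounded_fun (p : X -> R^o) <-> exists M, forall x, `|p x| <= M.
Proof.
split=> [[M [Mr pM]]|[M pM]].
  by exists (M + 1) => x; apply: pM => //; rewrite ltrDl.
exists M; split; rewrite ?num_real // => N MN x _.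
exact: le_trans (pM x) (ltW MN).
Qed.

Lemma bounded_cst c : bounded_fun ((fun=> c) : X -> R^o).
Proof. by apply/bounded_funE; exists `|c|. Qed.

Lemma bounded_lin a p q : bounded_fun (p : X -> R^o) ->
  bounded_fun (q : X -> R^o) -> bounded_fun ((fun x => a * p x + q x) : X -> R^o).
Proof.
move=> /bounded_funE[M pM] /bounded_funE[N qN]; apply/bounded_funE.
exists (`|a| * M + N) => x; apply: le_trans (ler_normD _ _) _.
by rewrite normrM lerD// ler_wpM2l.
Qed.

Variables (m : (X -> R) -> R) (mm : is_mean m).

Lemma mean0 : m (fun=> 0) = 0.
Proof.
have := mean_linear mm (-1) (bounded_cst 1) (bounded_cst 1).
have -> : (fun _ : X => -1 * 1 + 1) = (fun=> 0 : R) by apply/funext => x; ring.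
by rewrite mulN1r addNr.
Qed.

Lemma meanZ a p : bounded_fun (p : X -> R^o) -> m (fun x => a * p x) = a * m p.
Proof.
move=> bp; have := mean_linear mm a bp (bounded_cst 0); rewrite mean0 addr0 => <-.
by congr m; apply/funext => x; rewrite addr0.
Qed.

Lemma mean_cst c : m (fun=> c) = c.
Proof.
have -> : (fun=> c) = (fun _ : X => c * 1) by apply/funext => x; rewrite mulr1.
by rewrite meanZ ?(mean1 mm) ?mulr1//; exact: bounded_cst.
Qed.

Lemma mean_le p q : bounded_fun (p : X -> R^o) -> bounded_fun (q : X -> R^o) ->
  (forall x, p x <= q x) -> m p <= m q.
Proof.
move=> bp bq pq; have := mean_linear mm (-1) bp bq; rewrite mulN1r addrC => E.
rewrite -subr_ge0 -E; apply: (mean_ge0 mm); first exact: bounded_lin.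
by move=> x; rewrite mulN1r addrC subr_ge0.
Qed.

Lemma mean_norm_le p M : (forall x, `|p x| <= M) -> `|m p| <= M.
Proof.
move=> pM; have bp : bounded_fun (p : X -> R^o) by apply/bounded_funE; exists M.
have pB x : - M <= p x <= M by rewrite -ler_norml.
rewrite ler_norml; apply/andP; split.
  rewrite -[leLHS]mean_cst; apply: mean_le => //; first exact: bounded_cst.
  by move=> x; have /andP[] := pB x.
rewrite -[leRHS]mean_cst; apply: mean_le => //; first exact: bounded_cst.
by move=> x; have /andP[] := pB x.
Qed.

Lemma bounded_sum (I : eqType) (r : seq I) (a : I -> R) (p : I -> X -> R) :
  {in r, forall i, bounded_fun (p i : X -> R^o)} ->
  bounded_fun ((fun x => \sum_(i <- r) a i * p i x) : X -> R^o).
Proof.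
elim: r => [|i r IH] bp.
  have -> : (fun x => \sum_(i <- [::]) a i * p i x) = (fun=> 0).
    by apply/funext => x; rewrite big_nil.
  exact: bounded_cst.
have -> : (fun x => \sum_(i <- i :: r) a i * p i x) =
    (fun x => a i * p i x + \sum_(i <- r) a i * p i x).
  by apply/funext => x; rewrite big_cons.
apply: bounded_lin; first by apply: bp; rewrite mem_head.
by apply: IH => j jr; apply: bp; rewrite in_cons jr orbT.
Qed.

Lemma mean_sum (I : eqType) (r : seq I) (a : I -> R) (p : I -> X -> R) :
  {in r, forall i, bounded_fun (p i : X -> R^o)} ->
  m (fun x => \sum_(i <- r) a i * p i x) = \sum_(i <- r) a i * m (p i).
Proof.
elim: r => [|i r IH] bp.
  rewrite big_nil -[RHS]mean0; congr m; apply/funext => x; exact: big_nil.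
have bi : bounded_fun (p i : X -> R^o) by apply: bp; rewrite mem_head.
have br : {in r, forall i, bounded_fun (p i : X -> R^o)}.
  by move=> j jr; apply: bp; rewrite in_cons jr orbT.
rewrite big_cons -IH// -mean_linear//; last exact: bounded_sum.
by congr m; apply/funext => x; rewrite big_cons.
Qed.

End Means.

(** A filter above the image that contains [A] cannot contain its complement,
    so the ultrafilter upstairs must contain the preimage of [A]. *)
Lemma fmap_ultra (T U : Type) (f : T -> U) (F : set_system T) :
  UltraFilter F -> UltraFilter (f @ F).
Proof.
move=> FU; have FP : ProperFilter F := ultra_proper.
split; first exact: fmap_proper_filter.
move=> H HP FH; apply/seteqP; split=> [A HA|]; last exact: FH.
have [//|FnA] := in_ultra_setVsetC (f @^-1` A) FU.
have HnA : H (~` A) by apply: FH.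
by have /filter_ex [? []] : H (A `&` ~` A) by exact: filterI.
Qed.

Section LimitMean.
Variables (R : realType) (X : Type).

Lemma bounded_comp (p : X -> R) (f : X -> X) : bounded_fun (p : X -> R^o) ->
  bounded_fun ((p \o f) : X -> R^o).
Proof.
by move=> /bounded_funE[M pM]; apply/bounded_funE; exists M => x; exact: pM.
Qed.

(** The values on a bounded function stay in a compact interval, so they
    converge along any ultrafilter that refines [\oo]. *)
Lemma limit_mean (m : nat -> (X -> R) -> R) : (forall n, is_mean (m n)) ->
  exists M : (X -> R) -> R, is_mean M /\
    forall p q, bounded_fun (p : X -> R^o) -> bounded_fun (q : X -> R^o) ->
      (fun n => m n p - m n q) @ \oo --> (0 : R) -> M p = M q.
Proof.
move=> mm; have [U [UU Uoo]] := ultraFilterLemma (F := \oo) _.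
have UP : ProperFilter U := ultra_proper.
have cvgU p : bounded_fun (p : X -> R^o) ->
    (fun n => m n p) @ U --> lim ((fun n => m n p) @ U).
  move=> /bounded_funE[B pB].
  have FU : UltraFilter ((fun n => m n p) @ U) by exact: fmap_ultra.
  have : compact `[- B, B]%classic by exact: segment_compact.
  rewrite compact_ultra => /(_ _ FU); case.
    apply: (@filterE _ U) => n /=; rewrite in_itv/= -ler_norml.
    exact: (mean_norm_le (mm n) pB).
  move=> l [_ cl]; apply/cvg_ex; by exists l.
exists (fun p => lim ((fun n => m n p) @ U)); split.
  split.
  - move=> a p q bp bq; apply: cvg_lim => //.
    have -> : (fun n => m n (fun x => a * p x + q x)) =
       (fun n => a * m n p + m n q).
      by apply/funext => n; exact: mean_linear.
    by apply: cvgD; [apply: cvgMr; exact: cvgU | exact: cvgU].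
  - move=> p bp p0; apply: (limr_ge (cvgP _ (cvgU _ bp))).
    by apply: filterE => n; exact: (mean_ge0 (mm n)).
  - have -> : (fun n => m n (fun=> 1)) = (fun=> 1).
      by apply/funext => n; exact: (mean1 (mm n)).
    exact: lim_cst.
move=> p q bp bq pq; apply/eqP; rewrite -subr_eq0; apply/eqP.
have h1 : (fun n => m n p - m n q) @ U --> (0 : R).
  by apply: cvg_trans pq => A; exact: Uoo.
have h2 : (fun n => m n p - m n q) @ U -->
    lim ((fun n => m n p) @ U) - lim ((fun n => m n q) @ U).
  by apply: cvgB; exact: cvgU.
exact: (cvg_unique _ h2 h1).
Qed.

End LimitMean.

(** * The conjugation random walk *)

Section Walk.
Variables (R : realType) (G : groupType) (S : {fset G}).
Implicit Types (g x h : G).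

(* The identity makes the walk lazy: almost invariance can be tested against
   the function itself, and lower bounds persist from one step to the next. *)
Local Notation S1 := (1%g |` S)%fset.
Local Notation k := (#|` S1|%:R : R).

Lemma S1_1 : 1%g \in S1. Proof. exact: fset1U1. Qed.

Definition walk g n : G -> R := iter n (conj_avg S1) (fun x => (x == g)%:R).

Lemma walkS g n : walk g n.+1 = conj_avg S1 (walk g n). Proof. by []. Qed.

Lemma finsupported_walk g n : finsupported (walk g n).
Proof.
elim: n => [|n IH]; last exact: finsupported_avg.
by exists [fset g]%fset => x; rewrite inE => /negbTE /= ->.
Qed.

Lemma finsupported_walk_sq g n : finsupported (fun x => walk g n x ^+ 2).
Proof.
apply: (@finsupported_comp _ _ _ (fun z : R => z ^+ 2)); rewrite ?expr0n//.
exact: finsupported_walk.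
Qed.

Lemma walk_ge0 g n x : 0 <= walk g n x.
Proof.
elim: n x => [|n IH] x /=; first exact: ler0n.
by rewrite -/(walk g n); exact: conj_avg_ge0.
Qed.

Lemma total_walk g n : total (walk g n) = 1.
Proof.
elim: n => [|n IH]; last first.
  by rewrite walkS total_avg; [|exact: S1_1|exact: finsupported_walk].
rewrite (@totalE _ _ [fset g]%fset) ?big_seq_fset1 /= ?eqxx // => x.
by rewrite inE => /negbTE ->.
Qed.

Lemma walk_sq_gt0 g n : 0 < total (fun x => walk g n x ^+ 2).
Proof.
rewrite lt_neqAle total_ge0 ?andbT => [|x]; last exact: sqr_ge0.
apply/eqP => t0; have w0 x : walk g n x = 0.
  have := @ler_total1 _ _ _ x (finsupported_walk_sq g n) (fun=> sqr_ge0 _).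
  rewrite -t0 => w0; apply/eqP; rewrite -sqrf_eq0 eq_le w0 sqr_ge0 //.
have := total_walk g n.
rewrite (@totalE _ _ fset0) ?big_nil; last by move=> x _; exact: w0.
by move=> /eqP; rewrite eq_sym oner_eq0.
Qed.

Lemma walk_ind (P : G -> Prop) g n : P g ->
  (forall s x, s \in S1 -> P (x ^ s)%g -> P x) ->
  forall x, walk g n x != 0 -> P x.
Proof.
move=> Pg PS; elim: n => [|n IH] x /=.
  by case: (eqVneq x g) => [->|]; rewrite ?eqxx.
rewrite -/(walk g n); apply: contraNP => nPx; rewrite /conj_avg big_seq big1 ?mulr0//.
move=> s sS; apply/eqP; apply: contra_notT nPx => ws; apply: (PS s) => //.
exact: IH.
Qed.

Lemma walk_conjugate g n x : walk g n x != 0 -> exists h, x = (g ^ h)%g.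
Proof.
apply: (@walk_ind (fun x => exists h, x = (g ^ h)%g)); first by exists 1%g; rewrite conjg1.
by move=> s {}x _ [h xh]; exists (h * s^-1)%g; rewrite conjgM -xh conjgK.
Qed.

Lemma walk_ball g n L x : symmetric_subset S -> word_ball S L g ->
  walk g n x != 0 -> word_ball S (n.*2 + L) x.
Proof.
move=> Ssym gL; elim: n x => [|n IH] x /=.
  by case: (eqVneq x g) => [->|]; rewrite ?eqxx.
rewrite -/(walk g n) => /negP wx; apply: contrapT => nB; apply: wx.
apply/eqP; rewrite /conj_avg big_seq big1 ?mulr0// => s sS.
apply/eqP; apply: contra_notT nB => /IH ws.
have sB : word_ball S 1 s.
  move: sS; rewrite !inE => /orP[/eqP->|]; last exact: word_ball_gen.
  exact: word_ball1.
have -> : x = (s * (x ^ s) * s^-1)%g by rewrite conjgE !mulgA mulgV mul1g mulgK.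
have -> : (n.+1.*2 + L = 1 + (n.*2 + L) + 1)%N by rewrite doubleS; lia.
by apply: word_ballM; [exact: word_ballM|exact: word_ballV].
Qed.

(** The bijection from the conjugacy class of [g] onto the cosets of the
    centralizer, x g x^-1 |-> x C(g), extended by a dummy value off the class
    ([g ^ h] is h^-1 g h, whence the inverse). *)
Definition conj_coset g x : coset_space (centralizer g) :=
  exist _ (lcoset_set (centralizer g) (xget 1%g [set h | x = (g ^ h^-1)%g]))
    (ex_intro _ _ erefl).

Lemma conj_coset_act g s h :
  conj_coset g ((g ^ h) ^ s^-1)%g = coset_act s (conj_coset g (g ^ h)%g).
Proof.
have xg x : (exists t, x = g ^ t)%g ->
    x = (g ^ (xget 1%g [set h | x = (g ^ h^-1)%g])^-1)%g.
  move=> [t xt]; apply: (@xgetPex _ 1%g [set h | x = (g ^ h^-1)%g]).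
  by exists t^-1%g; rewrite /= invgK.
apply: eq_exist; rewrite /=.
have := xg (g ^ h)%g (ex_intro _ _ erefl).
have := xg ((g ^ h) ^ s^-1)%g (ex_intro _ (h * s^-1)%g (esym (conjgM _ _ _))).
set a := xget _ _; set b := xget _ _ => Ea Eb.
have cab : ((s * b)^-1 * a)%g \in centralizer g.
  have E : (g ^ (s * b)^-1)%g = (g ^ a^-1)%g.
    by rewrite -Ea Eb invgM conjgM.
  have /(congr1 (fun z => z ^ a)%g) := E.
  rewrite conjgKV -conjgM => E2; apply/eqP.
  by rewrite [RHS]conjgC E2.
apply/seteqP; split=> [_ [c Cc <-]|_ [_ [c Cc <-] <-]].
  exists (b * ((s * b)^-1 * a * c))%g; last first.
    by rewrite mulgA -[(_ * a * c)%g]mulgA mulVKg.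
  by exists ((s * b)^-1 * a * c)%g => //; exact: gpredM.
exists (((s * b)^-1 * a)^-1 * c)%g; first by apply: gpredM; rewrite ?gpredV.
by rewrite invgM invgK !mulgA mulgV mul1g.
Qed.

Hypothesis (Ssym : symmetric_subset S) (Sgen : generates S).

(** Either the square norms contract by a fixed factor, or for every [j] some
    step of the walk loses at most a proportion [e j ^+ 2]; in the second case
    the squares of these [phi j], normalized and pushed to the coset space, are
    means whose limit is invariant. *)
Lemma walk_decay g : ~ coamenable R (centralizer g) ->
  exists2 c : R, 0 < c < 1 &
    forall n, total (fun x => walk g n x ^+ 2) <= c ^+ n.
Proof.
move=> ncoam; pose a n := total (fun x => walk g n x ^+ 2).
have a0 : a 0%N <= 1.
  rewrite /a (@totalE _ _ [fset g]%fset) ?big_seq_fset1 /= ?eqxx ?expr1n // => x.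
  by rewrite inE => /negbTE ->; rewrite expr0n.
have [[c c01 ac]|nc] := pselect (exists2 c : R, 0 < c < 1 &
    forall n, a n.+1 <= c * a n).
  exists c => // n; have c0 : 0 <= c by case/andP: c01 => /ltW.
  elim: n => [|n IH]; first by rewrite expr0.
  by rewrite exprS; apply: le_trans (ac n) _; rewrite ler_wpM2l.
exfalso; apply: ncoam; pose e (j : nat) : R := (j.+2%:R)^-1.
have e0 j : 0 < e j by rewrite invr_gt0 ltr0n.
have e1 j : e j < 1 by rewrite invf_lt1 ?ltr1n ?ltr0n.
have step j : exists n, (1 - e j ^+ 2) * a n <= a n.+1.
  apply: contrapT => /forallNP H; apply: nc; exists (1 - e j ^+ 2).
    by rewrite subr_gt0 expr_lt1 ?(ltW (e0 j))// e1 ltrBlDr ltrDl exprn_gt0.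
  by move=> n; rewrite leNgt; apply/negP => /ltW; exact: H.
pose N j := sval (cid (step j)); have NP j := svalP (cid (step j)).
pose phi j := walk g (N j).
pose m j (p : coset_space (centralizer g) -> R) : R :=
  (a (N j))^-1 * total (fun x => phi j x ^+ 2 * p (conj_coset g x)).
have fphi j p : finsupported (fun x => phi j x ^+ 2 * p x).
  exact/finsupportedM/finsupported_walk_sq.
have agt0 n : 0 < a n := walk_sq_gt0 g n.
have mm j : is_mean (m j).
  split=> [c p q _ _|p _ p0|].
  - have fp := fphi j (p \o conj_coset g); have fq := fphi j (q \o conj_coset g).
    rewrite /m; set tp := total (fun x => _ * p _); set tq := total (fun x => _ * q _).
    have -> : (fun x => phi j x ^+ 2 * (c * p (conj_coset g x) + q (conj_coset g x)))
      = (fun x => c * (phi j x ^+ 2 * p (conj_coset g x)) +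
                  phi j x ^+ 2 * q (conj_coset g x)).
      by apply/funext => x; ring.
    rewrite totalD ?totalZ//; first by rewrite -/tp -/tq; ring.
    by apply: (@finsupported_comp _ _ _ (fun z : R => c * z)); rewrite ?mulr0.
  - rewrite mulr_ge0 ?invr_ge0 ?(ltW (agt0 _))// total_ge0// => x.
    by rewrite mulr_ge0 ?sqr_ge0.
  - rewrite /m -[X in X * _]/((a (N j))^-1).
    have -> : (fun x => phi j x ^+ 2 * 1) = (fun x => walk g (N j) x ^+ 2).
      by apply/funext => x; rewrite mulr1.
    by rewrite mulVf// lt0r_neq0.
have shift j s p : total (fun x => phi j x ^+ 2 * p (coset_act s (conj_coset g x)))
    = total (fun x => phi j (x ^ s)%g ^+ 2 * p (conj_coset g x)).
  rewrite -(total_conj _ s); congr total; apply/funext => x.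
  have [->|/walk_conjugate[h E]] := eqVneq (phi j (x ^ s)%g) 0.
    by rewrite expr0n !mul0r.
  by rewrite E -conj_coset_act -E conjgK.
have gen s p : s \in S -> bounded_fun (p : coset_space (centralizer g) -> R^o) ->
    (fun j => m j (p \o coset_act s) - m j p) @ \oo --> (0 : R).
  move=> sS /bounded_funE[B pB].
  have bnd j : `|m j (p \o coset_act s) - m j p| <= B * (2 * k + 2) * e j.
    rewrite /m -mulrBr normrM ger0_norm ?invr_ge0 ?(ltW (agt0 _))//=.
    rewrite shift ler_pdivrMl// mulrC.
    apply: (@sq_almost_invariant _ _ _ S1_1 _ _ _ _ (p \o conj_coset g)) => //.
    - exact: finsupported_walk.
    - by rewrite inE sS orbT.
    - by move=> x; exact: pB.
  apply/norm_cvg0P; apply: (@squeeze_cvgr _ _ _ _ (fun=> 0)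
    (fun j => B * (2 * k + 2) * e j)).
  - by apply: nearW => j; rewrite normr_ge0 bnd.
  - exact: cvg_cst.
  rewrite -[X in _ --> X](mulr0 (B * (2 * k + 2))); apply: cvgMr.
  by have := @cvg_harmonic R; rewrite -cvg_shiftS.
(* Invariance under the generators gives invariance under the whole group. *)
have [M [meanM Minv]] := limit_mean mm; exists M; split=> // x.
elim/(generates_ind Ssym Sgen): x => [|s x sS IH] p bp.
  congr M; apply/funext => A /=; congr p; case: A => A [h Ah].
  apply: eq_exist => /=; rewrite -[RHS]image_id; apply: eq_imagel => z _.
  exact: mul1g.
have -> : p \o @coset_act _ (centralizer g) (s * x)%g =
    (p \o @coset_act _ (centralizer g) s) \o @coset_act _ (centralizer g) x.
  apply/funext => -[A [h Ah]] /=; congr p; apply: eq_exist => /=.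
  by rewrite image_comp; apply: eq_imagel => z _ /=; rewrite mulgA.
rewrite IH; last exact: bounded_comp.
by apply: Minv => //; [exact: bounded_comp | exact: gen].
Qed.

End Walk.

(** * The norm of square-summable functions *)

Section Ell2Norm.
Variables (R : realType) (G : groupType).
Local Notation C := R[i].
Implicit Types (u v : ell2 R G).

Lemma normc1 : normc (1 : C) = 1.
Proof. by rewrite /normc /= expr1n expr0n /= addr0 sqrtr1. Qed.

Lemma normc_real (a : R) : 0 <= a -> normc (a%:C)%C = a.
Proof. by move=> a0; rewrite /normc /= expr0n /= addr0 sqrtr_sqr ger0_norm. Qed.

Lemma esum_nsq_ge0 (u : G -> C) :
  (0 <= \esum_(x in [set: G]) (normc (u x) ^+ 2)%:E)%E.
Proof. by apply: esum_ge0 => x _; rewrite lee_fin sqr_ge0. Qed.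

Lemma esum_nsq_le (u : G -> C) (r : R) :
  (\esum_(x in [set: G]) (normc (u x) ^+ 2)%:E <= r%:E)%E <->
  forall X : {fset G}, \sum_(x <- X) normc (u x) ^+ 2 <= r.
Proof.
split=> [le X|le].
  rewrite -lee_fin; apply: le_trans le; apply: esum_ge.
  exists [set` X]; first by split=> //; exact: finite_fset.
  by rewrite -fsbig_seq ?fset_uniq// sumEFin.
apply: ge_ereal_sup => _ [X [finX _] <-].
rewrite fsbig_finite//= sumEFin lee_fin; exact: le.
Qed.

(** The form in which the norm is used throughout: only finite sums occur. *)
Lemma l2norm_leP (u : G -> C) (r : R) : 0 <= r ->
  (l2norm u <= r%:E)%E <->
  forall X : {fset G}, \sum_(x <- X) normc (u x) ^+ 2 <= r ^+ 2.
Proof.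
move=> r0; rewrite -esum_nsq_le /l2norm.
have := esum_nsq_ge0 u; case: (\esum_(_ in _) _) => [s| |] //=.
- rewrite lee_fin => s0; rewrite powR12_sqrt// !lee_fin.
  rewrite -(@ler_pXn2r _ 2 isT _ r) ?nnegrE ?sqrtr_ge0// sqr_sqrtr//.
- by rewrite leye_eq invr_eq0 pnatr_eq0/= !leye_eq.
Qed.

Lemma square_summable_bound (u : G -> C) (r : R) : 0 <= r ->
  (forall X : {fset G}, \sum_(x <- X) normc (u x) ^+ 2 <= r ^+ 2) ->
  u \in @square_summable R G.
Proof.
by move=> r0 /(l2norm_leP _ r0) ur; apply/asboolP; apply: le_lt_trans ur (ltry _).
Qed.

(** Real-valued, since the norm of an element of l^2 is finite. *)
Definition nrm u : R := fine (l2norm u).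

Lemma l2norm_ge0 (u : G -> C) : (0 <= l2norm u)%E.
Proof. exact: poweR_ge0. Qed.

Lemma l2normE u : l2norm u = (nrm u)%:E.
Proof.
have /asboolP ul := ell2P u; rewrite /nrm fineK// ge0_fin_numE//.
exact: l2norm_ge0.
Qed.

Lemma nrm_ge0 u : 0 <= nrm u.
Proof. by rewrite -lee_fin -l2normE l2norm_ge0. Qed.

Lemma nrm_leP u r : 0 <= r ->
  nrm u <= r <-> forall X : {fset G}, \sum_(x <- X) normc (u x) ^+ 2 <= r ^+ 2.
Proof. by move=> r0; rewrite -lee_fin -l2normE; exact: l2norm_leP. Qed.

Lemma sum_nrm_le u (X : {fset G}) : \sum_(x <- X) normc (u x) ^+ 2 <= nrm u ^+ 2.
Proof. by move: X; apply/nrm_leP => //; exact: nrm_ge0. Qed.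

Lemma normc_le_nrm u x : normc (u x) <= nrm u.
Proof.
have := sum_nrm_le u [fset x]%fset; rewrite big_seq_fset1.
by rewrite ler_pXn2r ?nnegrE ?normc_ge0 ?nrm_ge0.
Qed.

Lemma nrm_eq0 u : nrm u = 0 -> u = 0.
Proof.
move=> u0; apply: val_inj; apply/funext => x; apply: eq0_normc.
by apply/eqP; rewrite eq_le normc_ge0 -{1}u0 normc_le_nrm.
Qed.

Lemma nrm0 : nrm 0 = 0.
Proof.
apply/eqP; rewrite eq_le nrm_ge0 andbT; apply/nrm_leP => // X.
by rewrite big1// => x _; rewrite normc0 expr0n.
Qed.

Lemma nrmZ_le (a : C) u : nrm (a *: u) <= normc a * nrm u.
Proof.
apply/nrm_leP => [|X]; first by rewrite mulr_ge0 ?normc_ge0 ?nrm_ge0.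
rewrite (eq_bigr (fun x => normc a ^+ 2 * normc (u x) ^+ 2)).
  by rewrite -mulr_sumr exprMn ler_wpM2l ?sqr_ge0 ?sum_nrm_le.
by move=> x _; rewrite -exprMn -normcM.
Qed.

Lemma nrmZ (a : C) u : nrm (a *: u) = normc a * nrm u.
Proof.
have [->|a0] := eqVneq a 0; first by rewrite scale0r normc0 mul0r nrm0.
apply/eqP; rewrite eq_le nrmZ_le /=.
have na : 0 < normc a.
  by rewrite lt_neqAle normc_ge0 andbT eq_sym; apply: contra_neq a0; exact: eq0_normc.
rewrite -ler_pdivlMl//; have := nrmZ_le a^-1 (a *: u).
rewrite scalerA mulVf// scale1r; congr (_ <= _ * _).
apply: (mulfI (lt0r_neq0 na)); rewrite mulfV ?lt0r_neq0//.
by rewrite -normcM mulfV// normc1.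
Qed.

Lemma nrmN u : nrm (- u) = nrm u.
Proof. by rewrite -scaleN1r nrmZ normcN normc1 mul1r. Qed.

(** Minkowski's inequality. The weights [a] and [b] exceed the norms by e/2 so
    that one can divide by them: (p + q)^2 <= (1 + b/a) p^2 + (1 + a/b) q^2, and
    the right-hand side sums to at most (a + b)^2. *)
Lemma nrmD u v : nrm (u + v) <= nrm u + nrm v.
Proof.
apply/ler_addgt0Pr => e e0; apply/nrm_leP => [|X].
  by rewrite ?addr_ge0 ?nrm_ge0 ?ltW.
pose a := nrm u + e / 2; pose b := nrm v + e / 2.
have a0 : 0 < a by rewrite ltr_wpDl ?nrm_ge0 ?divr_gt0.
have b0 : 0 < b by rewrite ltr_wpDl ?nrm_ge0 ?divr_gt0.
have -> : nrm u + nrm v + e = a + b by rewrite /a /b; field.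
have Ua : \sum_(x <- X) normc (u x) ^+ 2 <= a ^+ 2.
  by move: X; apply/nrm_leP; rewrite ?lerDl ?ltW// divr_gt0.
have Vb : \sum_(x <- X) normc (v x) ^+ 2 <= b ^+ 2.
  by move: X {Ua}; apply/nrm_leP; rewrite ?lerDl ?ltW// divr_gt0.
have pw x : normc ((u + v) x) ^+ 2 <=
    (1 + b / a) * normc (u x) ^+ 2 + (1 + a / b) * normc (v x) ^+ 2.
  have := le_normcD (u x) (v x); set p := normc (u x); set q := normc (v x).
  have -> : (u + v) x = u x + v x by [].
  move=> le; apply: (@le_trans _ _ ((p + q) ^+ 2)).
    by rewrite lerXn2r ?nnegrE ?addr_ge0 ?normc_ge0.
  rewrite -subr_ge0.
  have -> : (1 + b / a) * p ^+ 2 + (1 + a / b) * q ^+ 2 - (p + q) ^+ 2 =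
    (a * b)^-1 * (b * p - a * q) ^+ 2.
    by field; rewrite !lt0r_neq0.
  by rewrite mulr_ge0 ?sqr_ge0 ?invr_ge0 ?mulr_ge0 ?ltW.
apply: (le_trans (ler_sum _ (fun x _ => pw x))).
rewrite big_split /= -!mulr_sumr.
have -> : (a + b) ^+ 2 = (1 + b / a) * a ^+ 2 + (1 + a / b) * b ^+ 2.
  by field; rewrite !lt0r_neq0.
by apply: lerD; apply: ler_wpM2l => //; rewrite addr_ge0// divr_ge0// ltW.
Qed.

Lemma nrm_regular g u : nrm (regular g u) = nrm u.
Proof.
rewrite /nrm; congr (fine (_ `^ _)%E).
rewrite [RHS](@reindex_esum _ _ _ [set: G] _ (fun x => (g^-1 * x)%g)) //.
split=> // [x y _ _ /mulgI//|y _]; exists (g * y)%g => //; exact: mulKg.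
Qed.

Lemma delta_summable (y : G) :
  (fun x => (x == y)%:R : C) \in @square_summable R G.
Proof.
apply: (square_summable_bound ler01) => X; rewrite expr1n.
rewrite (eq_bigr (fun x => (x == y)%:R)).
  have [yX|yX] := boolP (y \in X).
    rewrite (big_fsetD1 y)//= eqxx big_seq big1 ?addr0// => x.
    by rewrite !inE => /andP[/negbTE ->].
  rewrite big_seq big1// => x xX; case: eqVneq => // xy.
  by rewrite -xy xX in yX.
by move=> x _; case: (x == y); rewrite ?normc1 ?normc0 ?expr1n ?expr0n.
Qed.

Definition delta (y : G) : ell2 R G := Ell2 (delta_summable y).

Lemma nrm_delta y : nrm (delta y) = 1.
Proof.
apply/eqP; rewrite eq_le; apply/andP; split; last first.
  by have := normc_le_nrm (delta y) y; rewrite /= eqxx normc1.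
apply/nrm_leP => // X; rewrite expr1n.
rewrite (eq_bigr (fun x => (x == y)%:R)).
  have [yX|yX] := boolP (y \in X).
    rewrite (big_fsetD1 y)//= eqxx big_seq big1 ?addr0// => x.
    by rewrite !inE => /andP[/negbTE ->].
  rewrite big_seq big1// => x xX; case: eqVneq => // xy.
  by rewrite -xy xX in yX.
by move=> x _ /=; case: (x == y); rewrite ?normc1 ?normc0 ?expr1n ?expr0n.
Qed.

End Ell2Norm.

(** * Bounds on operators *)

Section OperatorNorm.
Variables (R : realType) (G : groupType).
Local Notation C := R[i].
Implicit Types (u v : ell2 R G) (T U : ell2 R G -> ell2 R G).

(** A norm bound that does not presuppose linearity and adds up term by
    term; for linear operators it bounds [opnorm] ([opnorm_leP]). *)
Definition op_le T (r : R) := forall u, nrm (T u) <= r * nrm u.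

Lemma opnorm_leP T r : linear T -> 0 <= r -> (opnorm T <= r%:E)%E <-> op_le T r.
Proof.
move=> Tlin r0; have TZ a u : T (a *: u) = a *: T u.
  have T0 : T 0 = 0.
    have := Tlin (-1) 0 0; rewrite scaler0 addr0 scaleN1r addNr //.
  by have := Tlin a u 0; rewrite T0 !addr0.
split=> [le u|le].
  have [u0|u0] := eqVneq (nrm u) 0.
    rewrite (nrm_eq0 u0); have := TZ 0 u; rewrite !scale0r => ->.
    by rewrite nrm0 mulr0.
  have u_gt0 : 0 < nrm u by rewrite lt_neqAle eq_sym u0 nrm_ge0.
  pose c : C := ((nrm u)^-1)%:C%C.
  have nc : normc c = (nrm u)^-1 by rewrite normc_real// invr_ge0 ltW.
  have : (l2norm (T (c *: u)) <= r%:E)%E.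
    apply: le_trans le; apply: ereal_sup_ubound; exists (c *: u) => //.
    by rewrite /mkset l2normE lee_fin nrmZ nc mulVf.
  by rewrite l2normE lee_fin TZ nrmZ nc mulrC ler_pdivrMr.
apply: ge_ereal_sup => _ [u /= + <-]; rewrite !l2normE !lee_fin => u1.
by apply: le_trans (le u) _; rewrite -[leRHS]mulr1 ler_wpM2l.
Qed.

Lemma op_leD T U r s : op_le T r -> op_le U s -> op_le (T + U) (r + s).
Proof.
by move=> Tr Us u; apply: le_trans (nrmD _ _) _; rewrite mulrDl lerD.
Qed.

Lemma op_leZ (a : C) T r : op_le T r -> op_le (a *: T) (normc a * r).
Proof. by move=> Tr u; rewrite nrmZ -mulrA ler_wpM2l ?normc_ge0. Qed.

Lemma op_leN T r : op_le T r -> op_le (- T) r.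
Proof. by move=> Tr u; rewrite nrmN. Qed.

Lemma op_le_weaken T r s : r <= s -> op_le T r -> op_le T s.
Proof. by move=> rs Tr u; apply: le_trans (Tr u) _; rewrite ler_wpM2r ?nrm_ge0. Qed.

Lemma op_le_regular g : op_le (regular g) 1.
Proof. by move=> u; rewrite nrm_regular mul1r. Qed.

Lemma linear_regular g : linear (@regular R G g).
Proof. by move=> a u v; apply: val_inj. Qed.

Lemma linear_regular_alg f : linear (@regular_alg R G f).
Proof.
move=> a u v; rewrite /regular_alg scaler_sumr -big_split /=.
apply: eq_bigr => g _; rewrite linear_regular scalerDr !scalerA; congr (_ *: _ + _).
by rewrite mulrC.
Qed.

Lemma ell2_sumE (I : Type) (r : seq I) (F : I -> ell2 R G) x :
  (\sum_(i <- r) F i : ell2 R G) x = \sum_(i <- r) F i x.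
Proof. by elim: r => [|i r IH]; rewrite ?big_nil// !big_cons -IH. Qed.

Lemma regular_algE (f : group_algebra R G) (A : {fset G}) u x :
  (finsupp f `<=` A)%fset -> regular_alg f u x = \sum_(g <- A) f g * u (g^-1 * x)%g.
Proof.
move=> fA; rewrite /regular_alg ell2_sumE (eq_bigr (fun g => f g * u (g^-1 * x)%g))//.
apply: big_fset_incl => // g _; rewrite memNfinsupp => /eqP fg.
by rewrite fg mul0r.
Qed.

Lemma op_le_regular_alg f :
  op_le (@regular_alg R G f) (\sum_(g <- finsupp f) normc (f g)).
Proof.
rewrite /op_le /regular_alg => u; elim: (enum_fset (finsupp f)) => [|g r IH].
  by rewrite !big_nil nrm0 mul0r.
rewrite !big_cons mulrDl; apply: le_trans (nrmD _ _) _.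
by rewrite lerD// nrmZ nrm_regular.
Qed.

End OperatorNorm.

(** * Consequences of sub-rapid decay *)

Section RapidDecay.
Variables (R : realType) (G : groupType) (S : {fset G}).
Local Notation C := R[i].

Lemma decay_fun_eventually : sub_rapid_decay R S -> forall d : R, 1 < d ->
  exists N, forall n, (N <= n)%N -> (decay_fun R S n <= (d ^+ n)%:E)%E.
Proof.
move=> srd d d1; have d0 : 0 < d := lt_trans ltr01 d1.
have : (limn_esup (fun n => decay_fun R S n `^ (n%:R^-1)) < d%:E)%E.
  by apply: le_lt_trans srd _; rewrite lte_fin.
rewrite /limn_esup => /ereal_inf_lt[_ [V [N _ NV] <-]] supV.
exists N.+1 => n Nn; have n0 : (0 < n)%N by apply: leq_trans Nn.
have : (decay_fun R S n `^ (n%:R^-1) < d%:E)%E.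
  apply: le_lt_trans supV; apply: ereal_sup_ubound; exists n => //.
  by apply: NV; apply: leq_trans Nn.
case: (decay_fun R S n) => [x| |]; last by rewrite leNye.
  rewrite poweR_EFin lte_fin lee_fin => xd.
  have [x0|x0] := leP 0 x; last first.
    by apply: (le_trans (ltW x0)); rewrite exprn_ge0// ltW.
  rewrite -[x]powRr1// -(@mulVf _ (n%:R : R)) ?pnatr_eq0 -?lt0n//.
  by rewrite powRrM powR_mulrn ?powR_ge0// lerXn2r ?nnegrE ?powR_ge0// ltW.
rewrite /= invr_eq0 pnatr_eq0 eqn0Ngt n0 /=.
by rewrite ltNge leey.
Qed.

Lemma srd_bound : sub_rapid_decay R S -> forall d : R, 1 < d ->
  exists N, forall n, (N <= n)%N -> forall (f : group_algebra R G) (r : R),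
    0 <= r -> [set` finsupp f] `<=` word_ball S n ->
    (forall X : {fset G}, \sum_(x <- X) normc (f x) ^+ 2 <= r ^+ 2) ->
    op_le (regular_alg f) (d ^+ n * r).
Proof.
move=> srd d d1; have [N HN] := decay_fun_eventually srd d1.
exists N => n /HN dec f r r0 fB fr; have d0 : 0 < d := lt_trans ltr01 d1.
have dr0 : 0 <= d ^+ n * r by rewrite mulr_ge0// exprn_ge0// ltW.
have [f0|/fset0Pn[x0 x0f]] := eqVneq (finsupp f) fset0.
  move=> u; apply: le_trans (op_le_regular_alg _ _) _.
  by rewrite f0 big_seq_fset0 mul0r mulr_ge0 ?nrm_ge0.
have flr : (l2norm f <= r%:E)%E by apply/l2norm_leP.
have : l2norm f \is a fin_num.
  by rewrite ge0_fin_numE ?l2norm_ge0//; apply: le_lt_trans flr (ltry _).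
move=> /fineK; set s := fine (l2norm f) => fs.
have s0 : 0 <= s by rewrite -lee_fin fs l2norm_ge0.
have s_gt0 : 0 < s.
  have : normc (f x0) ^+ 2 <= s ^+ 2.
    have fls : (l2norm f <= s%:E)%E by rewrite fs.
    by have := (l2norm_leP f s0).1 fls [fset x0]%fset; rewrite big_seq_fset1.
  rewrite ler_pXn2r ?nnegrE ?normc_ge0//; apply: lt_le_trans.
  rewrite lt_neqAle normc_ge0 andbT eq_sym.
  by move: x0f; rewrite mem_finsupp; apply: contra_neq; exact: eq0_normc.
apply/opnorm_leP => //; first exact: linear_regular_alg.
have : (opnorm (regular_alg f) / l2norm f <= (d ^+ n)%:E)%E.
  apply: le_trans dec; apply: ereal_sup_ubound; exists f => //; split=> //.
  by apply/fset0Pn; exists x0.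
rewrite -fs inver gt_eqF// lee_pdivrMr// => /le_trans; apply.
rewrite -EFinM lee_fin ler_wpM2l// ?exprn_ge0 ?(ltW d0)//.
by rewrite -lee_fin fs.
Qed.

(** Exponential decay of the l^2 norms beats the subexponential factor. With
    c = t^8 the l^2 norm at step n is at most K t^(4n); taking 1/t as the growth
    rate, the factor at radius 2n + L is at most t^-(2n + L), and K t^-L t^(2n)
    remains. *)
Lemma srd_decay : sub_rapid_decay R S ->
  forall (c K : R) (L : nat) (f : nat -> group_algebra R G), 0 < c < 1 -> 0 <= K ->
    (forall n, [set` finsupp (f n)] `<=` word_ball S (n.*2 + L)) ->
    (forall n (X : {fset G}), \sum_(x <- X) normc (f n x) ^+ 2 <= K ^+ 2 * c ^+ n) ->
  forall e : R, 0 < e -> exists N, forall n, (N <= n)%N ->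
    op_le (regular_alg (f n)) e.
Proof.
move=> srd c K L f /andP[c0 c1] K0 fB fc e e0.
pose t := Num.sqrt (Num.sqrt (Num.sqrt c)).
have t0 : 0 < t by rewrite !sqrtr_gt0.
have ct : c = t ^+ 8.
  rewrite -[8%N]/(2 * (2 * 2))%N !exprM !sqr_sqrtr ?sqrtr_ge0//.
  exact: ltW.
have t1 : t < 1.
  by rewrite ltNge; apply/negP => t1; move: c1; rewrite ct ltNge exprn_ege1.
have d1 : 1 < t^-1 by rewrite invf_gt1.
have [N HN] := srd_bound srd d1.
have : (fun n => K * t^-1 ^+ L * (t ^+ 2) ^+ n) @ \oo --> (0 : R).
  rewrite -[X in _ --> X](mulr0 (K * t^-1 ^+ L)); apply: cvgMr.
  by apply: cvg_expr; rewrite ger0_norm ?exprn_ge0 ?(ltW t0)// expr_lt1// ltW.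
move=> /cvgrPdist_lt /(_ e e0) [N' _ HN'].
exists (maxn N N') => n; rewrite geq_max => /andP[Nn N'n].
have Nn2 : (N <= n.*2 + L)%N by apply: (leq_trans Nn); lia.
have Kt0 : 0 <= K * (t ^+ 4) ^+ n by rewrite mulr_ge0// !exprn_ge0// ltW.
apply: op_le_weaken (HN _ Nn2 (f n) _ Kt0 (fB n) _); last first.
  move=> X; apply: le_trans (fc n X) _.
  by rewrite exprMn ct -!exprM mulnAC.
have := HN' n N'n; rewrite /= sub0r normrN => /ltW; apply: le_trans.
apply: le_trans (ler_norm _); rewrite exprD -muln2 mulnC.
rewrite exprM.
have -> : (t ^+ 4) ^+ n = (t ^+ 2) ^+ n * (t ^+ 2) ^+ n.
  by rewrite -exprMn -exprD.
have -> : (t^-1 ^+ 2) ^+ n * t^-1 ^+ L * (K * ((t ^+ 2) ^+ n * (t ^+ 2) ^+ n)) =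
  K * t^-1 ^+ L * (t ^+ 2) ^+ n * ((t^-1 ^+ 2) ^+ n * (t ^+ 2) ^+ n) by ring.
by rewrite -exprMn -exprMn mulVf ?expr1n ?mulr1 ?lt0r_neq0.
Qed.

End RapidDecay.

(** * Kesten's inequality for amenable subgroups *)

Section SuperHarmonic.
Variables (R : realType) (G : groupType) (S : {fset G}).
Hypotheses (Ssym : symmetric_subset S) (Sgen : generates S).
Local Notation C := R[i].
Variables (f : group_algebra R G) (phi : G -> R) (r r' : R).
Hypotheses (f_phi : forall x, f x = (phi x)%:C%C) (phi0 : forall x, 0 <= phi x).
Hypotheses (phi_gt0 : forall s, s \in S -> 0 < phi s).
Hypotheses (fr : op_le (regular_alg f) r) (rr' : r < r').

Let A := finsupp f.

(** [green n] is lambda(f)^n delta_1, computed with the real coefficients. *)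
Fixpoint green n (x : G) : R :=
  if n is n.+1 then \sum_(g <- A) phi g * green n (g^-1 * x)%g else (x == 1%g)%:R.

Lemma green_ge0 n x : 0 <= green n x.
Proof.
by elim: n x => [|n IH] x /=; rewrite ?ler0n// sumr_ge0// => g _; rewrite mulr_ge0.
Qed.

Lemma op_le_ge0 : 0 <= r.
Proof. by have := fr (delta R 1%g); rewrite nrm_delta mulr1; apply: le_trans; exact: nrm_ge0. Qed.

Let r'_gt0 : 0 < r' := le_lt_trans op_le_ge0 rr'.

Lemma green_le n x : green n x <= r ^+ n.
Proof.
pose v := iter n (regular_alg f) (delta R 1%g).
have vE y : v y = (green n y)%:C%C.
  rewrite /v; elim: n y {v} => [|n IH] y /=.
    by case: (y == 1%g).
  rewrite (regular_algE _ _ (fsubset_refl A)) (raddf_sum (real_complex R)).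
  by apply: eq_bigr => g _; rewrite IH f_phi -rmorphM.
have vr : nrm v <= r ^+ n.
  rewrite /v; elim: n {v vE} => [|n IH] /=; first by rewrite nrm_delta expr0.
  by apply: le_trans (fr _) _; rewrite exprS ler_wpM2l ?op_le_ge0.
apply: le_trans vr; rewrite -(normc_real (green_ge0 n x)) -vE.
exact: normc_le_nrm.
Qed.

Let term x n := green n x / r' ^+ n.

Let term_ge0 x n : 0 <= term x n.
Proof. by rewrite divr_ge0 ?green_ge0 ?exprn_ge0 ?(ltW r'_gt0). Qed.

Lemma is_cvg_green x : cvgn (series (term x)).
Proof.
apply: (@series_le_cvg _ _ (geometric 1 (r / r'))).
- exact: term_ge0.
- by move=> n; rewrite geometric_ge0 ?divr_ge0 ?op_le_ge0 ?(ltW r'_gt0).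
- move=> n; rewrite /term /= mul1r expr_div_n.
  by rewrite ler_wpM2r ?invr_ge0 ?exprn_ge0 ?(ltW r'_gt0)// green_le.
apply: is_cvg_geometric_series; rewrite ger0_norm ?divr_ge0 ?op_le_ge0 ?(ltW r'_gt0)//.
by rewrite ltr_pdivrMr ?mul1r.
Qed.

(** psi = sum_n r'^-n lambda(f)^n delta_1. Applying lambda(f) shifts the index,
    so the result is r' (psi - delta_1). The series converges since the n-th
    term is at most (r / r')^n, and psi > 0 spreads from 1 along the generators,
    which have positive weight. *)
Lemma superharmonic_exists : exists psi : G -> R,
  (forall x, 0 < psi x) /\
  forall x, \sum_(g <- A) phi g * psi (g^-1 * x)%g <= r' * psi x.
Proof.
pose psi x := limn (series (term x)).
have mono x : nondecreasing_seq (series (term x)).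
  apply/nondecreasing_seqP => n; rewrite seriesSr lerDl; exact: term_ge0.
have le_psi x n : series (term x) n <= psi x.
  by apply: nondecreasing_cvgn_le => //; exact: is_cvg_green.
have psi0 x : 0 <= psi x.
  by apply: le_trans (le_psi x 0%N); rewrite /series /= big_geq.
have super x : \sum_(g <- A) phi g * psi (g^-1 * x)%g <= r' * psi x.
  have lim : (fun n => \sum_(g <- A) phi g * series (term (g^-1 * x)%g) n) @ \oo
      --> \sum_(g <- A) phi g * psi (g^-1 * x)%g.
    apply: (cvg_big add_continuous) => g _; apply: cvgMr; exact: is_cvg_green.
  rewrite -(cvg_lim _ lim)//; apply: limr_le; first by apply/cvg_ex; eexists; exact: lim.
  apply: nearW => n; apply: (@le_trans _ _ (r' * series (term x) n.+1)); last first.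
    by rewrite ler_wpM2l ?(ltW r'_gt0)// le_psi.
  have -> : \sum_(g <- A) phi g * series (term (g^-1 * x)%g) n =
      r' * \sum_(0 <= i < n) term x i.+1.
    rewrite mulr_sumr; under eq_bigr => g _ do rewrite /series /= mulr_sumr.
    rewrite exchange_big /=; apply: eq_bigr => i _.
    rewrite /term /= mulr_suml mulr_sumr; apply: eq_bigr => g _.
    rewrite exprS; field; rewrite !lt0r_neq0 ?exprn_gt0//.
  rewrite ler_wpM2l ?(ltW r'_gt0)// /series /= big_nat_recl//= lerDr.
  exact: term_ge0.
exists psi; split=> //; apply: (generates_ind Ssym Sgen).
  apply: lt_le_trans (le_psi _ 1%N); rewrite /series /= big_nat1 /term /= eqxx.
  by rewrite expr0 divr1.
move=> s x sS psix; rewrite -(pmulr_rgt0 _ r'_gt0).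
apply: lt_le_trans (super _); rewrite (big_fsetD1 s) /=; last first.
  rewrite mem_finsupp f_phi; apply/eqP => /(congr1 (@complex.Re R)) /= ps.
  by have := phi_gt0 sS; rewrite ps ltxx.
rewrite mulKg ltr_wpDr ?mulr_gt0 ?phi_gt0// sumr_ge0// => g _.
by rewrite mulr_ge0.
Qed.

End SuperHarmonic.

Section AmenableSubgroup.
Variables (R : realType) (G : groupType) (S : {fset G}).
Hypotheses (Ssym : symmetric_subset S) (Sgen : generates S).
Variables (f : group_algebra R G) (phi : G -> R) (r : R).
Hypotheses (f_phi : forall x, f x = (phi x)%:C%C) (phi0 : forall x, 0 <= phi x).
Hypotheses (phiV : forall x, phi (x^-1)%g = phi x).
Hypotheses (phi_gt0 : forall s, s \in S -> 0 < phi s).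
Hypotheses (fr : op_le (regular_alg f) r).

(** The tangent line of the concave function ln at [c]. *)
Lemma ln_tangent (c y : R) : 0 < c -> 0 < y -> ln y <= y / c - 1 + ln c.
Proof.
move=> c0 y0; rewrite -lerBlDr -ln_div ?posrE//.
have -> : y / c = 1 + (y / c - 1) by ring.
by rewrite [leRHS]addrAC subrr add0r le_ln1Dx// ltrBrDl addrN divr_gt0.
Qed.

(** If the mass [F] of [f] on [H] exceeded the norm, choose r' between them and
    take psi as above. The functions [q t] are bounded by the Harnack inequality
    and m (q t^-1) = - m (q t), so sum f(t) m (q t) = 0 by symmetry of [f].
    But pointwise sum f(t) q t <= F ln (r' / F) < 0. *)
Lemma amenable_sum_le (H : groupClosed G) : amenable R (subgroup_type H) ->
  \sum_(t <- finsupp f | t \in H) phi t <= r.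
Proof.
move=> [m [mm minv]]; set F := \sum_(_ <- _ | _) _.
rewrite leNgt; apply/negP => rF.
have r0 := op_le_ge0 fr; have F0 : 0 < F := le_lt_trans r0 rF.
have [r' rr' r'F] : exists2 r', r < r' & r' < F.
  by exists ((r + F) / 2); [have [] := midf_lt rF | have [] := midf_lt rF].
have r'0 : 0 < r' := le_lt_trans r0 rr'.
have [psi [psi0 super]] := superharmonic_exists Ssym Sgen f_phi phi0 phi_gt0 fr rr'.
pose q t (x : subgroup_type H) := ln (psi (t^-1 * sgval x)%g) - ln (psi (sgval x)).
pose ts := [seq t <- finsupp f | t \in H].
have suppE t : (t \in finsupp f) = (0 < phi t).
  by rewrite mem_finsupp f_phi fmorph_eq0 lt_def phi0 andbT.
(* One term of the sum in [super]; with [t^-1] it gives the reverse bound. *)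
have harnack t x : 0 < phi t -> phi t * psi (t^-1 * x)%g <= r' * psi x.
  move=> pt; apply: le_trans (super x).
  rewrite (big_fsetD1 t) ?suppE//= lerDl sumr_ge0// => g _.
  by rewrite mulr_ge0// ltW.
have bq t : 0 < phi t -> bounded_fun (q t : subgroup_type H -> R^o).
  move=> pt; apply/bounded_funE; exists (ln (r' / phi t)) => x.
  have ptV : 0 < phi (t^-1)%g by rewrite phiV.
  have h1 := harnack t (sgval x) pt.
  have h2 := harnack (t^-1)%g (t^-1 * sgval x)%g ptV.
  rewrite invgK mulVKg phiV in h2.
  rewrite ler_norml /q -!ln_div ?posrE// -lnV ?posrE ?divr_gt0//.
  rewrite !ler_ln ?posrE ?invr_gt0 ?divr_gt0//; apply/andP; split.
    by rewrite invf_div ler_pdivlMr// mulrAC ler_pdivrMr// [leRHS]mulrC.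
  by rewrite ler_pdivrMr// mulrAC ler_pdivlMr// mulrC.
have tsP t : t \in ts -> 0 < phi t /\ t \in H.
  by rewrite mem_filter suppE => /andP[].
have btsq : {in ts, forall t, bounded_fun (q t : subgroup_type H -> R^o)}.
  by move=> t /tsP[pt _]; exact: bq.
pose A := \sum_(t <- ts) phi t * m (q t).
have mqV t : t \in ts -> m (q (t^-1)%g) = - m (q t).
  move=> /tsP[pt tH]; pose h : subgroup_type H := SubgroupElt tH.
  have -> : q (t^-1)%g = (fun x => -1 * q t x) \o (fun x => (h * x)%g).
    apply/funext => x /=; rewrite /q.
    have -> : sgval (h * x)%g = (t * sgval x)%g by [].
    by rewrite invgK mulKg; ring.
  rewrite minv.
    by rewrite meanZ// ?mulN1r//; exact: bq.
  have /bounded_funE[M qM] := bq t pt; apply/bounded_funE; exists M => x.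
  by rewrite mulN1r normrN.
have A0 : A = 0.
  have AN : A = - A.
    have pe : perm_eq ts [seq (t^-1)%g | t <- ts].
      apply: uniq_perm; first by rewrite filter_uniq ?fset_uniq.
        by rewrite map_inj_uniq ?filter_uniq ?fset_uniq//; exact: invg_inj.
      move=> t; rewrite mem_filter suppE; apply/andP/mapP.
        move=> [tH pt]; exists (t^-1)%g; last by rewrite invgK.
        by rewrite mem_filter suppE phiV pt gpredV tH.
      move=> [u + ->]; rewrite mem_filter suppE => /andP[uH pu].
      by rewrite phiV gpredV.
    rewrite {1}/A (perm_big _ pe) /= big_map -sumrN big_seq [RHS]big_seq.
    by apply: eq_bigr => t tts; rewrite phiV mqV// mulrN.
  have : A + A = 0 by rewrite {1}AN addNr.
  by lra.
have FE : F = \sum_(t <- ts) phi t by rewrite /ts big_filter.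
have bound x : \sum_(t <- ts) phi t * q t x <= F * ln (r' / F).
  pose c := r' / F; have c0 : 0 < c by rewrite divr_gt0.
  pose y t := psi (t^-1 * sgval x)%g / psi (sgval x).
  apply: (@le_trans _ _ (\sum_(t <- ts) phi t * (y t / c - 1 + ln c))).
    apply: ler_sum => t _; rewrite ler_wpM2l// /q -ln_div ?posrE//.
    by apply: ln_tangent => //; rewrite divr_gt0.
  have -> : \sum_(t <- ts) phi t * (y t / c - 1 + ln c) =
      c^-1 * (\sum_(t <- ts) phi t * y t) + (ln c - 1) * F.
    rewrite FE !mulr_sumr -big_split/=; apply: eq_bigr => t _; ring.
  have yle : \sum_(t <- ts) phi t * y t <= r'.
    have -> : \sum_(t <- ts) phi t * y t =
       (\sum_(t <- ts) phi t * psi (t^-1 * sgval x)%g) / psi (sgval x).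
      by rewrite mulr_suml; apply: eq_bigr => t _; rewrite mulrA.
    rewrite ler_pdivrMr//; apply: le_trans (super _).
    rewrite /ts big_filter [leRHS](bigID (mem H))/= lerDl sumr_ge0// => t _.
    by rewrite mulr_ge0// ltW.
  have : c^-1 * (\sum_(t <- ts) phi t * y t) <= F.
    rewrite ler_pdivrMl//; apply: le_trans yle _.
    by rewrite /c divfK ?lt0r_neq0.
  rewrite -/c; lra.
have : A <= F * ln (r' / F).
  rewrite /A -mean_sum// -[leRHS](mean_cst mm); apply: mean_le => //.
    exact: bounded_sum.
  exact: bounded_cst.
rewrite A0 leNgt nmulr_llt0; first by rewrite F0.
by rewrite ln_lt0// divr_gt0//= ltr_pdivrMr// mul1r.
Qed.

End AmenableSubgroup.

(** * Topological freeness *)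

Section GroupAlgebraElement.
Variables (R : realType) (G : groupType).
Local Notation C := R[i].

Lemma group_algebra_of (phi : G -> R) : finsupported phi ->
  exists f : group_algebra R G, forall x, f x = (phi x)%:C%C.
Proof.
move=> [A phiA]; exists [fsfun x in A => (phi x)%:C%C] => x.
by rewrite fsfunE; case: ifPn => // /phiA ->.
Qed.

Lemma sum_normc_le_total (phi : G -> R) (f : group_algebra R G) (X : {fset G}) :
  finsupported phi -> (forall x, 0 <= phi x) -> (forall x, f x = (phi x)%:C%C) ->
  \sum_(x <- X) normc (f x) ^+ 2 <= total (fun x => phi x ^+ 2).
Proof.
move=> [A phiA] phi0 f_phi.
have sqA : supported A (fun x => phi x ^+ 2) by move=> x /phiA ->; rewrite expr0n.
rewrite (totalE (supportedUr (A := X) sqA)).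
rewrite (eq_bigr (fun x => phi x ^+ 2)); last first.
  by move=> x _; rewrite f_phi normc_real.
rewrite [leRHS](big_fsetID _ (mem X)) /=.
have -> : [fset x in (X `|` A)%fset | x \in X]%fset = X.
  by apply/fsetP => x; rewrite !inE; case: (x \in X); rewrite ?andbF.
by rewrite lerDl sumr_ge0// => x _; exact: sqr_ge0.
Qed.

End GroupAlgebraElement.

Section StabilizerMass.
Variables (R : realType) (G : groupType) (S : {fset G}).
Hypotheses (Ssym : symmetric_subset S) (Sgen : generates S).
Variables (X : compact_gspace G) (g : G).
Local Notation S1 := (1%g |` S)%fset.
Local Notation k := (#|` S1|%:R : R).

Lemma nbhd_stabilizerJ (h s : G) (y : X) : h \in nbhd_stabilizer y ->
  (h ^ s)%g \in nbhd_stabilizer (gact X (s^-1)%g y).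
Proof.
move=> /asboolP[V [oV Vy] hV]; apply/asboolP.
exists (gact X s @^-1` V).
  split; last by rewrite /= -gactM mulgV gact1.
  by apply: open_comp oV => z _; exact: gact_continuous.
by move=> z Vz; rewrite conjgE !gactM hV// -gactM mulVg gact1.
Qed.

Lemma nbhd_stabilizerJE (h s : G) (y : X) :
  ((h ^ s)%g \in nbhd_stabilizer (gact X (s^-1)%g y)) = (h \in nbhd_stabilizer y).
Proof.
apply/idP/idP; last exact: nbhd_stabilizerJ.
by move=> /(@nbhd_stabilizerJ _ (s^-1)%g); rewrite conjgK -gactM invgK mulgV gact1.
Qed.

Definition stab_mass n (y : X) : R :=
  total (fun x => walk R S g n x * (x \in nbhd_stabilizer y)%:R).

Lemma stab_mass_ge0 n y : 0 <= stab_mass n y.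
Proof. by apply: total_ge0 => x; rewrite mulr_ge0 ?walk_ge0. Qed.

(** The stabilizer of s^-1 y is the conjugate of that of y, so the mass, as a
    function on the space, is averaged along the action. *)
Lemma stab_massS n y :
  stab_mass n.+1 y = k^-1 * \sum_(s <- S1) stab_mass n (gact X (s^-1)%g y).
Proof.
pose F s x := walk R S g n (x ^ s)%g * ((x ^ s)%g \in nbhd_stabilizer (gact X (s^-1)%g y))%:R.
have fF s : finsupported (F s).
  by apply: finsupportedM; apply: finsupported_conj; exact: finsupported_walk.
rewrite /stab_mass walkS.
have -> : (fun x => conj_avg S1 (walk R S g n) x * (x \in nbhd_stabilizer y)%:R) =
    (fun x => k^-1 * \sum_(s <- S1) F s x).
  apply/funext => x; rewrite /conj_avg -mulrA mulr_suml; congr (_ * _).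
  by apply: eq_bigr => s _; rewrite /F nbhd_stabilizerJE.
rewrite totalZ ?total_sum//; last exact: finsupported_sum.
congr (_ * _); apply: eq_bigr => s _.
exact: (total_conj (fun x => walk R S g n x * (x \in nbhd_stabilizer _)%:R)).
Qed.

Let k_gt0 : 0 < k := card_gt0 R (fset1U1 1%g S).

Lemma stab_massS_ge n s y : s \in S1 ->
  k^-1 * stab_mass n (gact X (s^-1)%g y) <= stab_mass n.+1 y.
Proof.
move=> sS; rewrite stab_massS ler_wpM2l ?invr_ge0 ?(ltW k_gt0)//.
by rewrite (big_fsetD1 s)//= lerDl sumr_ge0// => t _; exact: stab_mass_ge0.
Qed.

Hypothesis Xmin : minimal X.
Variable U : set X.
Hypotheses (oU : open U) (U0 : U !=set0) (gU : forall y, U y -> gact X g y = y).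

(** A word for [t] of length n leads from [U], where the initial mass is 1, to
    t U in n steps, each keeping at least the fraction 1/k; afterwards, staying
    put keeps the same fraction. *)
Lemma stab_mass_local t : exists n, forall m y, (n <= m)%N ->
  U (gact X (t^-1)%g y) -> k^-1 ^+ m <= stab_mass m y.
Proof.
suff [n Hn] : exists n, forall y, U (gact X (t^-1)%g y) -> k^-1 ^+ n <= stab_mass n y.
  exists n => m y /subnK <- Uy; elim: (m - n)%N => [|d IH]; first exact: Hn.
  rewrite addSn exprS; apply: le_trans (stab_massS_ge (d + n)%N y (fset1U1 1%g S)).
  by rewrite invg1 gact1 ler_wpM2l// invr_ge0 ltW.
elim/(generates_ind Ssym Sgen): t => [|s t sS [n IH]].
  exists 0%N => y; rewrite invg1 gact1 => Uy.
  rewrite expr0 /stab_mass (@totalE _ _ [fset g]%fset) ?big_seq_fset1 /=.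
    rewrite eqxx mul1r; have -> : g \in nbhd_stabilizer y; last by [].
    by apply/asboolP; exists U.
  by move=> x; rewrite inE => /negbTE ->; rewrite mul0r.
exists n.+1 => y; rewrite invgM gactM => /IH le.
rewrite exprS; apply: le_trans (stab_massS_ge n y (s := s) _).
  by rewrite ler_wpM2l// invr_ge0 ltW.
by rewrite inE sS orbT.
Qed.

(** Minimality moves every point into [U] and compactness makes the number of
    steps uniform; a lower bound valid everywhere survives averaging. *)
Lemma stab_mass_bound : exists2 e : R, 0 < e &
  exists m, forall n y, (m <= n)%N -> e <= stab_mass n y.
Proof.
have [m _ Hm] : \forall m \near \oo, [set: X] `<=` (fun y => k^-1 ^+ m <= stab_mass m y).
  move/compact_near_coveringP: (@gspace_compact _ X); apply=> y _.
  have [z [Uz [t _ tz]]] := Xmin y U0 oU.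
  have [n Hn] := stab_mass_local (t^-1)%g.
  exists (gact X t @^-1` U, [set m | (n <= m)%N]); last first.
    by move=> [y' m] /= [Uy' nm]; apply: Hn => //; rewrite invgK.
  split; last by exists n.
  apply: open_nbhs_nbhs; split; last by rewrite /= tz.
  by apply: open_comp oU => z' _; exact: gact_continuous.
exists (k^-1 ^+ m); first by rewrite exprn_gt0 // invr_gt0.
exists m => n y /subnK <-; elim: (n - m)%N y => [|d IH] y; first exact: Hm (leqnn m) y I.
rewrite addSn stab_massS ler_pdivlMl// -sumr_const_fset.
by apply: ler_sum => s _; exact: IH.
Qed.

End StabilizerMass.

Section TopologicallyFree.
Variables (R : realType) (G : groupType) (S : {fset G}).
Hypotheses (Ssym : symmetric_subset S) (Sgen : generates S).
Hypothesis SRD : sub_rapid_decay R S.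
Local Notation S1 := (1%g |` S)%fset.
Local Notation k := (#|` S1|%:R : R).

Lemma walkV g n x : walk R S (g^-1)%g n x = walk R S g n (x^-1)%g.
Proof.
elim: n x => [|n IH] x /=; first by rewrite -(inj_eq invg_inj) invgK.
by congr (_ * _); apply: eq_bigr => s _; rewrite -!/(walk R S _ n) IH conjVg.
Qed.

(** [walk g n] plus [walk g^-1 n], which makes the function symmetric as
    Kesten's inequality needs, plus a small multiple of the indicator of the
    generators, which makes the Green function positive everywhere. *)
Definition sym_walk (e : R) g n x : R :=
  walk R S g n x + walk R S g n (x^-1)%g + e ^+ n * (x \in S1)%:R.

Lemma finsupported_sym_walk e g n : finsupported (sym_walk e g n).
Proof.
apply: finsupportedD; [apply: finsupportedD|].
- exact: finsupported_walk.
- have [A HA] := finsupported_walk R S (g^-1)%g n.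
  by exists A => x /HA; rewrite walkV.
- by exists S1 => x /negbTE ->; rewrite mulr0.
Qed.

Lemma sym_walk_sq_le (e c : R) g n : e ^+ 2 = c ->
  total (fun x => walk R S g n x ^+ 2) <= c ^+ n ->
  total (fun x => sym_walk e g n x ^+ 2) <= 3 * (2 + k) * c ^+ n.
Proof.
move=> ec wc.
have fV : finsupported (fun x => walk R S g n (x^-1)%g ^+ 2).
  have [A HA] := finsupported_walk R S (g^-1)%g n.
  by exists A => x /HA; rewrite walkV => ->; rewrite expr0n.
have fS : finsupported (fun x : G => (x \in S1)%:R : R).
  by exists S1 => x /negbTE ->.
have fZ a (p : G -> R) : finsupported p -> finsupported (fun x => a * p x).
  by move=> [A HA]; exists A => x /HA ->; rewrite mulr0.
have fw := finsupported_walk_sq R S g n.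
apply: (@le_trans _ _ (total (fun x => 3 * walk R S g n x ^+ 2 +
   (3 * walk R S g n (x^-1)%g ^+ 2 + 3 * c ^+ n * (x \in S1)%:R)))).
  apply: ler_total.
  - have [A HA] := finsupported_sym_walk e g n.
    by exists A => x /HA ->; rewrite expr0n.
  - by apply: finsupportedD; [|apply: finsupportedD]; exact: fZ.
  move=> x; rewrite /sym_walk; set a := walk _ _ _ _ _; set b := walk _ _ _ _ _.
  have -> : 3 * c ^+ n * (x \in S1)%:R = 3 * (e ^+ n * (x \in S1)%:R) ^+ 2.
    by rewrite -ec -exprM mulnC exprM; case: (x \in S1) => /=; ring.
  set d := e ^+ n * _.
  have := sqr_ge0 (a - b); have := sqr_ge0 (a - d); have := sqr_ge0 (b - d); nra.
rewrite totalD ?totalD ?totalZ//; try by [exact: fZ|apply: finsupportedD; exact: fZ].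
rewrite (@total_reindex _ _ (fun x => x^-1)%g (fun x => walk R S g n x ^+ 2)); last first.
  by exists (fun x => x^-1)%g; exact: invgK.
rewrite (@totalE _ _ S1 (fun x => (x \in S1)%:R)) => [|x /negbTE ->//].
have -> : \sum_(x <- S1) (x \in S1)%:R = k.
  rewrite big_seq (eq_bigr (fun=> 1)) => [|x ->//].
  by rewrite -big_seq sumr_const_fset mulr1.
have k0 : 0 <= k by exact: ler0n.
nra.
Qed.

(** With [e ^+ 2 = c] the added multiple [e ^+ n] of the generators has square
    norm of the order of [c ^+ n] and does not spoil the decay. *)
Lemma srd_topologically_free g : ~ coamenable R (centralizer g) ->
  forall X : compact_gspace G, minimal X ->
    amenable_nbhd_stabilizers X R -> topologically_free X g.
Proof.
move=> /(walk_decay Ssym Sgen)[c c01 wc] X Xmin Xam.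
have [c0 _] := andP c01.
apply: contrapT => /eqP/set0P[x0 x0U].
set U := interior _ in x0U.
have oU : open U by exact: open_interior.
have gU y : U y -> gact X g y = y by move=> /interior_subset.
have [d d0 [m Hm]] := stab_mass_bound R Ssym Sgen Xmin oU (ex_intro _ x0 x0U) gU.
have [L gL] := word_ball_exhausts Ssym Sgen g.
pose e := Num.sqrt c; have ec : e ^+ 2 = c by rewrite sqr_sqrtr// ltW.
have e_gt0 : 0 < e by rewrite sqrtr_gt0.
pose phi n := sym_walk e g n.
have phi0 n x : 0 <= phi n x.
  by rewrite !addr_ge0 ?walk_ge0 ?mulr_ge0 ?exprn_ge0 ?ler0n ?(ltW e_gt0).
have fphi n : finsupported (phi n) := finsupported_sym_walk e g n.
pose f n := sval (cid (group_algebra_of (fphi n))).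
have f_phi n : forall x, f n x = (phi n x)%:C%C := svalP (cid (group_algebra_of (fphi n))).
have S1V x : (x^-1 \in S1)%g = (x \in S1).
  have imp y : y \in S1 -> (y^-1 \in S1)%g.
    by rewrite !inE => /orP[/eqP->|/Ssym->]; rewrite ?invg1 ?eqxx ?orbT.
  by apply/idP/idP => [/imp|/imp//]; rewrite invgK.
have phiV n x : phi n (x^-1)%g = phi n x.
  by rewrite /phi /sym_walk invgK S1V [X in X + _]addrC.
have phiS n s : s \in S -> 0 < phi n s.
  move=> sS; rewrite ltr_wpDl ?addr_ge0 ?walk_ge0//.
  by rewrite inE sS orbT mulr1 exprn_gt0.
have fB n : [set` finsupp (f n)] `<=` word_ball S (n.*2 + L.+1).
  move=> x; rewrite /= mem_finsupp f_phi fmorph_eq0 => px.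
  have [wx|wx] := eqVneq (walk R S g n x) 0; last first.
    by apply: word_ball_mono (walk_ball Ssym gL wx); rewrite leq_add2l.
  have [wVx|wVx] := eqVneq (walk R S g n (x^-1)%g) 0; last first.
    apply: (@word_ball_mono _ _ (n.*2 + L)); first by rewrite leq_add2l.
    by rewrite -[x]invgK; apply: word_ballV => //; exact: walk_ball wVx.
  have xS : x \in S1.
    by apply: contraNT px => /negbTE xS; rewrite /phi /sym_walk wx wVx xS mulr0 !addr0.
  apply: (@word_ball_mono _ _ 1); first by rewrite addnS.
  by move: xS; rewrite !inE => /orP[/eqP->|/word_ball_gen//]; exact: word_ball1.
pose K := Num.sqrt (3 * (2 + k)).
have fK n (Y : {fset G}) : \sum_(x <- Y) normc (f n x) ^+ 2 <= K ^+ 2 * c ^+ n.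
  apply: le_trans (sum_normc_le_total _ (fphi n) (phi0 n) (f_phi n)) _.
  by rewrite sqr_sqrtr ?mulr_ge0 ?addr_ge0//; exact: sym_walk_sq_le.
have d2 : 0 < d / 2 by rewrite divr_gt0.
have [N HN] := srd_decay SRD c01 (sqrtr_ge0 _ : 0 <= K) fB fK d2.
pose n := maxn m N; have Nn : (N <= n)%N by rewrite leq_maxr.
have := @amenable_sum_le _ _ _ Ssym Sgen _ _ _ (f_phi n) (phi0 n) (phiV n) (phiS n)
  (HN n Nn) (nbhd_stabilizer x0) (Xam x0).
apply/negP; rewrite -ltNge; apply: (@lt_le_trans _ _ d).
  by rewrite ltr_pdivrMr// ltr_pMr// ltr1n.
apply: le_trans (Hm n x0 (leq_maxl _ _)) _.
have -> : \sum_(t <- finsupp (f n) | t \in nbhd_stabilizer x0) phi n t =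
   total (fun x => phi n x * (x \in nbhd_stabilizer x0)%:R).
  rewrite big_mkcond /= (@totalE _ _ (finsupp (f n))) => [|x].
    by apply: eq_bigr => x _; case: ifP; rewrite ?mulr1 ?mulr0.
  by rewrite mem_finsupp negbK f_phi fmorph_eq0 => /eqP ->; rewrite mul0r.
apply: ler_total; try by [exact/finsupportedM/finsupported_walk | exact/finsupportedM].
move=> x; rewrite ler_wpM2r ?ler0n// /phi /sym_walk -addrA lerDl addr_ge0 ?walk_ge0//.
by rewrite mulr_ge0 ?exprn_ge0 ?ler0n// ltW.
Qed.

End TopologicallyFree.

(** * Simplicity of the reduced algebra *)

Section OperatorAverage.
Variables (R : realType) (G : groupType) (S : {fset G}).
Local Notation C := R[i].
Local Notation S1 := (1%g |` S)%fset.
Local Notation k := (#|` S1|%:R : R).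
Implicit Types (T U : ell2 R G -> ell2 R G) (u v : ell2 R G).

Let k_gt0 : 0 < k := card_gt0 R (fset1U1 1%g S).
Local Notation kC := ((k^-1)%:C%C : C).

Lemma nrm_sum (I : Type) (r : seq I) (F : I -> ell2 R G) :
  nrm (\sum_(i <- r) F i) <= \sum_(i <- r) nrm (F i).
Proof.
elim: r => [|i r IH]; first by rewrite !big_nil nrm0.
by rewrite !big_cons; apply: le_trans (nrmD _ _) _; rewrite lerD2l.
Qed.

(** The average of the conjugates of [T] by lambda(s), s in [S1]; on lambda(f)
    it acts as [conj_avg] on the coefficients ([avg_op_regular_alg]). *)
Definition avg_op T : ell2 R G -> ell2 R G := fun u =>
  kC *: \sum_(s <- S1) regular s (T (regular (s^-1)%g u)).

Lemma regularM s t u : regular s (regular t u) = regular (s * t)%g u.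
Proof. by apply: val_inj; apply/funext => x /=; rewrite invgM mulgA. Qed.

Lemma regular1 u : regular 1%g u = u.
Proof. by apply: val_inj; apply/funext => x /=; rewrite invg1 mul1g. Qed.

Lemma regularZD s (a : C) u v : regular s (a *: u + v) = a *: regular s u + regular s v.
Proof. exact: linear_regular. Qed.

Lemma avg_op_lin (a : C) T U : avg_op (a *: T + U) = a *: avg_op T + avg_op U.
Proof.
apply/funext => u; rewrite /avg_op.
rewrite (eq_bigr (fun s => a *: regular s (T (regular (s^-1)%g u)) +
   regular s (U (regular (s^-1)%g u)))); last by move=> s _; exact: regularZD.
by rewrite big_split /= -scaler_sumr scalerDr scalerA mulrC -scalerA.
Qed.

Lemma iter_avg_op_lin n (a : C) T U :
  iter n avg_op (a *: T + U) = a *: iter n avg_op T + iter n avg_op U.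
Proof. by elim: n => [//|n IH] /=; rewrite IH avg_op_lin. Qed.

Lemma iter_avg_opB n T U :
  iter n avg_op (T - U) = iter n avg_op T - iter n avg_op U.
Proof. by rewrite addrC -scaleN1r iter_avg_op_lin scaleN1r addrC. Qed.

Lemma normc_kC : normc kC = k^-1.
Proof. by rewrite normc_real// invr_ge0 ltW. Qed.

Lemma op_le_avg T r : op_le T r -> op_le (avg_op T) r.
Proof.
move=> Tr u; rewrite nrmZ normc_kC ler_pdivrMl//.
apply: le_trans (nrm_sum _ _) _; rewrite -sumr_const_fset; apply: ler_sum => s _.
by rewrite nrm_regular; apply: le_trans (Tr _) _; rewrite nrm_regular.
Qed.

Lemma op_le_iter_avg n T r : op_le T r -> op_le (iter n avg_op T) r.
Proof. by move=> Tr; elim: n => [//|n IH] /=; exact: op_le_avg. Qed.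

Lemma sum_kC u : kC *: \sum_(s <- S1) u = u.
Proof.
rewrite big_const_seq count_predT iter_addr_0 -[u *+ _]scaler_nat scalerA.
have -> : (#|` S1|%:R : C) = k%:C%C by rewrite rmorph_nat.
by rewrite -rmorphM mulVf ?lt0r_neq0// scale1r.
Qed.

Lemma avg_op_id : avg_op id = id.
Proof.
apply/funext => u; rewrite /avg_op -[RHS]sum_kC; congr (_ *: _).
by apply: eq_bigr => s _; rewrite regularM mulgV regular1.
Qed.

Lemma iter_avg_op_id n : iter n avg_op id = id.
Proof. by elim: n => [//|n IH] /=; rewrite IH avg_op_id. Qed.

Lemma regular_alg_widen (f : group_algebra R G) (A : {fset G}) u :
  (finsupp f `<=` A)%fset -> regular_alg f u = \sum_(g <- A) f g *: regular g u.
Proof.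
move=> fA; apply: big_fset_incl => // g _; rewrite memNfinsupp => /eqP ->.
by rewrite scale0r.
Qed.

Lemma avg_op_regular_alg (f f' : group_algebra R G) :
  (forall x, f' x = kC * \sum_(s <- S1) f (x ^ s)%g) ->
  avg_op (regular_alg f) = regular_alg f'.
Proof.
move=> f'E; apply/funext => u; rewrite /avg_op.
(* [B] carries [f'] and all the conjugates of the support of [f]. *)
pose B := (finsupp f' `|` [fset (g ^ s^-1)%g | g in finsupp f, s in S1])%fset.
rewrite (@regular_alg_widen f' B) ?fsubsetUl//.
rewrite [RHS](eq_bigr (fun h => kC *: \sum_(s <- S1) f (h ^ s)%g *: regular h u)); last first.
  by move=> h _; rewrite f'E -scalerA scaler_suml.
rewrite -scaler_sumr exchange_big /=; congr (_ *: _).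
rewrite big_seq [RHS]big_seq; apply: eq_bigr => s sS.
pose D := [fset (g ^ s^-1)%g | g in finsupp f]%fset.
transitivity (\sum_(h <- D) f (h ^ s)%g *: regular h u).
  rewrite big_imfset /=; last by move=> g h _ _; exact: conjg_inj.
  rewrite /regular_alg.
  have rs : regular s (\sum_(g <- finsupp f) f g *: regular g (regular (s^-1)%g u)) =
     \sum_(g <- finsupp f) f g *: regular s (regular g (regular (s^-1)%g u)).
    elim: (enum_fset (finsupp f)) => [|g r IH].
      by rewrite !big_nil -[X in regular s X](scale0r 0) -[X in regular s X]addr0
        regularZD scale0r add0r; apply: val_inj.
    by rewrite !big_cons regularZD IH.
  rewrite rs; apply: eq_bigr => g _; rewrite conjgKV !regularM.
  by rewrite conjgE invgK !mulgA.
apply: big_fset_incl => [|h _ hD].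
  apply/fsubsetP => h /imfsetP[g /= gf ->]; rewrite in_fsetU; apply/orP; right.
  by apply/imfset2P; exists g => //; exists s.
suff -> : f (h ^ s)%g = 0 by rewrite scale0r.
apply/eqP; rewrite -memNfinsupp; apply: contra hD => hf.
by apply/imfsetP; exists (h ^ s)%g => //=; rewrite conjgK.
Qed.

Lemma subopE T U u x : (T - U) u x = T u x - U u x.
Proof. by []. Qed.

Lemma linear_subop T U : linear T -> linear U -> linear (T - U).
Proof.
move=> Tl Ul a u v; rewrite -![(T - U) _]/(T _ - U _) Tl Ul scalerBr opprD.
by rewrite addrACA.
Qed.

Lemma opnorm_lt T r e : linear T -> 0 <= r -> op_le T r -> r < e ->
  (opnorm T < e%:E)%E.
Proof.
move=> Tl r0 Tr re; apply: (@le_lt_trans _ _ r%:E); last by rewrite lte_fin.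
exact/opnorm_leP.
Qed.

Lemma reduced_cstar_approx T : reduced_cstar T ->
  linear T /\ forall e : R, 0 < e ->
    exists f : group_algebra R G, op_le (T - regular_alg f) e.
Proof.
move=> [[Tlin _] Tapp]; split=> // e e0; have [f fe] := Tapp e e0; exists f.
apply/opnorm_leP; [|exact: ltW|exact: ltW].
exact/linear_subop/linear_regular_alg.
Qed.

Lemma regular_alg_fsfun1 (s : G) :
  exists2 f : group_algebra R G, forall x, f x = ((x == s)%:R : R)%:C%C &
    regular_alg f = regular s.
Proof.
have fs : finsupported (fun x => (x == s)%:R : R).
  by exists [fset s]%fset => x; rewrite inE => /negbTE ->.
have [f fE] := group_algebra_of fs; exists f => //; apply/funext => u.
rewrite (@regular_alg_widen f [fset s]%fset) ?big_seq_fset1 ?fE ?eqxx ?scale1r//.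
apply/fsubsetP => x; rewrite mem_finsupp fE inE fmorph_eq0 pnatr_eq0.
by case: (x == s).
Qed.

Lemma reduced_cstar_regular s : reduced_cstar (@regular R G s).
Proof.
split.
  split; first exact: linear_regular.
  apply: (@le_lt_trans _ _ 1%:E); last exact: ltry.
  by apply/opnorm_leP => //; [exact: linear_regular|exact: op_le_regular].
move=> e e0; have [f _ fE] := regular_alg_fsfun1 s; exists f; rewrite fE subrr.
apply: (@opnorm_lt _ 0) => //; last by move=> u; rewrite nrm0 mul0r.
by move=> a u v; rewrite scaler0 addr0.
Qed.

Lemma reduced_cstar_id : reduced_cstar (id : ell2 R G -> ell2 R G).
Proof.
have -> : id = @regular R G 1%g by apply/funext => u; rewrite regular1.
exact: reduced_cstar_regular.
Qed.

Lemma ideal_avg (J : set (ell2 R G -> ell2 R G)) T :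
  closed_ideal J -> J T -> J (avg_op T).
Proof.
move=> Jid JT; have -> : avg_op T =
    kC *: \sum_(s <- S1) (regular s \o (T \o regular (s^-1)%g)).
  by apply/funext => u; rewrite /avg_op; congr (_ *: _); rewrite fct_sumE.
apply: (idealZ Jid); elim: (enum_fset S1) => [|s r IH].
  by rewrite big_nil; exact: (ideal0 Jid).
rewrite big_cons; apply: (idealD Jid) => //.
have rs t := reduced_cstar_regular t.
exact: (Defs.idealMl Jid (rs s) (Defs.idealMr Jid JT (rs (s^-1)%g))).
Qed.

Lemma ideal_iter_avg (J : set (ell2 R G -> ell2 R G)) n T :
  closed_ideal J -> J T -> J (iter n avg_op T).
Proof. by move=> Jid JT; elim: n => [//|n IH] /=; exact: ideal_avg. Qed.

Definition averages_out T := forall e : R, 0 < e ->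
  exists N, forall n, (N <= n)%N -> op_le (iter n avg_op T) e.

Lemma averages_out_lin (a : C) T U :
  averages_out T -> averages_out U -> averages_out (a *: T + U).
Proof.
move=> Tv Uv e e0; have a1 : 0 < normc a + 1 by rewrite ltr_wpDl ?normc_ge0.
have e1 : 0 < e / 2 / (normc a + 1) by rewrite !divr_gt0.
have e2 : 0 < e / 2 by rewrite divr_gt0.
have [N HN] := Tv _ e1; have [M HM] := Uv _ e2; exists (maxn N M) => n.
rewrite geq_max => /andP[Nn Mn]; rewrite iter_avg_op_lin.
have le := op_leD (op_leZ a (HN n Nn)) (HM n Mn); apply: op_le_weaken le.
rewrite [leRHS](_ : e = e / 2 + e / 2); last by field.
rewrite lerD2r mulrCA ger_pMr// ler_pdivrMr// mul1r lerDl //.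
Qed.

Lemma averages_out_sum (r : seq G) (a : G -> C) (F : G -> ell2 R G -> ell2 R G) :
  {in r, forall g, averages_out (F g)} -> averages_out (\sum_(g <- r) a g *: F g).
Proof.
elim: r => [|g r IH] Fr.
  rewrite big_nil => e e0; exists 0%N => n _; apply: op_le_iter_avg => u.
  by rewrite nrm0 mulr_ge0 ?nrm_ge0// ltW.
rewrite big_cons; apply: averages_out_lin; first by apply: Fr; rewrite mem_head.
by apply: IH => h hr; apply: Fr; rewrite in_cons hr orbT.
Qed.

Hypotheses (Ssym : symmetric_subset S) (Sgen : generates S).
Hypothesis SRD : sub_rapid_decay R S.

(** The n-th average of lambda(t) is lambda of the n-th step of the walk. *)
Lemma averages_out_regular t : ~ coamenable R (centralizer t) ->
  averages_out (@regular R G t).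
Proof.
move=> /(walk_decay Ssym Sgen)[c c01 wc] e e0.
have [L tL] := word_ball_exhausts Ssym Sgen t.
pose f n := sval (cid (group_algebra_of (finsupported_walk R S t n))).
have f_walk n : forall x, f n x = (walk R S t n x)%:C%C :=
  svalP (cid (group_algebra_of (finsupported_walk R S t n))).
have fB n : [set` finsupp (f n)] `<=` word_ball S (n.*2 + L).
  move=> x; rewrite /= mem_finsupp f_walk fmorph_eq0; exact: walk_ball.
have fc n (X : {fset G}) : \sum_(x <- X) normc (f n x) ^+ 2 <= 1 ^+ 2 * c ^+ n.
  rewrite expr1n mul1r; apply: le_trans (wc n).
  apply: (sum_normc_le_total X (finsupported_walk R S t n)); last exact: f_walk.
  exact: walk_ge0.
have [N HN] := srd_decay SRD c01 ler01 fB fc e0.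
exists N => n /HN; congr (op_le _ _).
have [f1 f1E <-] := regular_alg_fsfun1 t.
elim: n => [|n /= <-].
  by rewrite /=; congr regular_alg; apply/fsfunP => x; rewrite f1E f_walk.
apply/esym/avg_op_regular_alg => x; rewrite !f_walk walkS /conj_avg rmorphM.
by congr (_ * _); rewrite rmorph_sum; apply: eq_bigr => s _; rewrite f_walk.
Qed.

Hypothesis ncoam : forall t : G, t <> 1%g -> ~ coamenable R (centralizer t).

Lemma averages_out_regular_alg (f : group_algebra R G) :
  averages_out (regular_alg f - f 1%g *: id).
Proof.
pose A := (1%g |` finsupp f)%fset.
have -> : regular_alg f - f 1%g *: id =
    \sum_(g <- (A `\ 1%g)%fset) f g *: @regular R G g.
  apply/funext => u; rewrite -[LHS]/(regular_alg f u - f 1%g *: u).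
  rewrite (@regular_alg_widen f A) ?fsubsetUr// (big_fsetD1 1%g) ?fset1U1//=.
  by rewrite regular1 addrAC subrr add0r fct_sumE.
apply: averages_out_sum => g; rewrite !inE => /andP[/eqP g1 _].
exact/averages_out_regular/ncoam.
Qed.

(** If lambda(f) is close to [T], then T delta_1 = 0 makes lambda(f) delta_1 = f
    small in l^2, so by Cauchy-Schwarz the values of lambda(f) u are small for
    each [u], and with them those of T u. *)
Lemma reduced_cstar_delta1 T : reduced_cstar T -> T (delta R 1%g) = 0 -> T = 0.
Proof.
move=> /reduced_cstar_approx[_ Tapp] T1; apply/funext => u; apply: val_inj.
apply/funext => x /=; apply: eq0_normc; apply/eqP; rewrite eq_le normc_ge0 andbT.
apply/ler_addgt0Pr => d d0; rewrite add0r.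
pose M := 1 + nrm u + nrm u ^+ 2.
have M0 : 0 < M by rewrite /M -addrA ltr_pwDl// addr_ge0 ?sqr_ge0 ?nrm_ge0.
pose e := d / M; have e0 : 0 < e by exact: divr_gt0.
have [f fe] := Tapp e e0.
have fsq (X : {fset G}) : \sum_(g <- X) normc (f g) ^+ 2 <= e ^+ 2.
  have : nrm (regular_alg f (delta R 1%g)) <= e.
    have := fe (delta R 1%g); rewrite -[X in nrm X]/(T _ - regular_alg f _) T1.
    by rewrite sub0r nrmN nrm_delta mulr1.
  move=> /nrm_leP => /(_ (ltW e0) X); apply: le_trans; apply: ler_sum => g _.
  rewrite le_eqVlt; apply/orP; left; apply/eqP; congr (normc _ ^+ 2).
  rewrite (@regular_algE _ _ f (g |` finsupp f)%fset) ?fsubsetUr//.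
  rewrite (big_fsetD1 g) ?fset1U1//= mulVg eqxx mulr1 big_seq big1 ?addr0//.
  move=> h; rewrite !inE => /andP[hg _]; case: eqP => [hg1|_]; last by rewrite mulr0.
  by move: hg; rewrite -[h]mulg1 -hg1 mulVKg eqxx.
have fu : normc (regular_alg f u x) <= e + e * nrm u ^+ 2.
  rewrite (regular_algE _ _ (fsubset_refl _)).
  apply: (@le_trans _ _ (\sum_(g <- finsupp f) normc (f g) * normc (u (g^-1 * x)%g))).
    elim: (enum_fset (finsupp f)) => [|g r IH]; first by rewrite !big_nil normc0.
    rewrite !big_cons; apply: le_trans (le_normcD _ _) _.
    by rewrite normcM lerD2l.
  apply: (@le_trans _ _ (\sum_(g <- finsupp f) (e^-1 * normc (f g) ^+ 2 +
      e * normc (u (g^-1 * x)%g) ^+ 2))).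
    apply: ler_sum => g _; set a := normc _; set b := normc _.
    have -> : e^-1 * a ^+ 2 + e * b ^+ 2 = e^-1 * (a ^+ 2 + (e * b) ^+ 2).
      by field; exact: lt0r_neq0.
    have -> : a * b = e^-1 * (a * (e * b)) by field; exact: lt0r_neq0.
    rewrite ler_wpM2l ?invr_ge0 ?(ltW e0)//.
    have := sqr_ge0 (a - e * b); have := sqr_ge0 a; have := sqr_ge0 (e * b); nra.
  rewrite big_split /= -!mulr_sumr lerD//.
    by rewrite ler_pdivrMl// -expr2.
  rewrite ler_wpM2l ?(ltW e0)//.
  have := sum_nrm_le u [fset (g^-1 * x)%g | g in finsupp f]%fset.
  by rewrite big_imfset //= => g h _ _ /mulIg/invg_inj.
have -> : T u x = (T u - regular_alg f u) x + regular_alg f u x.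
  by rewrite [X in _ = X + _](_ : _ = T u x - regular_alg f u x) ?subrK.
apply: le_trans (le_normcD _ _) _.
apply: (@le_trans _ _ (e * nrm u + (e + e * nrm u ^+ 2))).
  by apply: lerD => //; apply: le_trans (normc_le_nrm _ _) (fe u).
have -> : e * nrm u + (e + e * nrm u ^+ 2) = e * M by rewrite /M; ring.
by rewrite /e divfK ?lt0r_neq0.
Qed.

(** A nonzero element of the ideal has a nonzero matrix coefficient at some
    (x, 1); translating by x^-1 and rescaling gives [T] in the ideal with
    coefficient 1 at (1, 1). The averages of [T] are near those of an
    approximating lambda(f), which tend to f(1), and f(1) is near 1. *)
Lemma srd_cstar_simple : cstar_simple R G.
Proof.
move=> J Jid; have [J0|] := pselect (forall T, J T -> T = 0).
  left; apply/seteqP; split=> [T /J0 ->//|T ->]; exact: (ideal0 Jid).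
move=> /existsNP[T0 /not_implyP[JT0 T0n]]; right.
have redT0 := ideal_sub Jid JT0.
have [x zx] : exists x, T0 (delta R 1%g) x != 0.
  apply: contrapT => /forallNP H; apply: T0n; apply: reduced_cstar_delta1 => //.
  apply: val_inj; apply/funext => x; have /negP := H x.
  by rewrite negbK => /eqP.
pose T := (T0 (delta R 1%g) x)^-1 *: (regular (x^-1)%g \o T0).
have JT : J T.
  exact: (idealZ Jid _ (Defs.idealMl Jid (reduced_cstar_regular _) JT0)).
have T1 : T (delta R 1%g) 1%g = 1.
  rewrite -[LHS]/((T0 (delta R 1%g) x)^-1 * T0 (delta R 1%g) (x^-1^-1 * 1)%g).
  by rewrite invgK mulg1 mulVf.
suff Jid1 : J id.
  apply/seteqP; split; first exact: (ideal_sub Jid).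
  by move=> U rU; exact: (Defs.idealMl Jid rU Jid1).
apply: (ideal_closed Jid); first exact: reduced_cstar_id.
move=> e e0; have e4 : 0 < e / 4 by rewrite divr_gt0.
have [Tlin Tapp] := reduced_cstar_approx (ideal_sub Jid JT).
have [f fe] := Tapp _ e4.
have f1 : normc (1 - f 1%g) <= e / 4.
  have := fe (delta R 1%g); rewrite nrm_delta mulr1; apply: le_trans.
  apply: le_trans (normc_le_nrm _ 1%g).
  rewrite subopE.
  rewrite T1 (@regular_algE _ _ f (1%g |` finsupp f)%fset) ?fsubsetUr//.
  rewrite (big_fsetD1 1%g) ?fset1U1//= mulVg eqxx mulr1 big_seq big1 ?addr0//.
  move=> h; rewrite !inE mulg1 invg_eq1 => /andP[/negbTE -> _]; exact: mulr0.
have [N HN] := averages_out_regular_alg f e4.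
exists (iter N avg_op T); first exact: ideal_iter_avg.
have [Ulin _] := reduced_cstar_approx (ideal_sub Jid (ideal_iter_avg N Jid JT)).
have E : id - iter N avg_op T = (1 - f 1%g) *: id +
    (- iter N avg_op (regular_alg f - f 1%g *: id) - iter N avg_op (T - regular_alg f)).
  have fid : iter N avg_op (f 1%g *: id) = f 1%g *: id.
    rewrite -[f 1%g *: id]addr0 iter_avg_op_lin iter_avg_op_id.
    suff -> : iter N avg_op 0 = 0 by [].
    by rewrite -[X in iter _ _ X](subrr id) iter_avg_opB subrr.
  rewrite !iter_avg_opB fid scalerBl scale1r !opprB.
  by rewrite !subrKA.
apply: (@opnorm_lt _ (e / 4 * 1 + (e / 4 + e / 4))).
- by apply: linear_subop Ulin => a u v.
- by rewrite mulr1 !addr_ge0// ltW.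
- rewrite E; apply: op_leD.
    apply: (op_le_weaken (r := normc (1 - f 1%g) * 1)); first by rewrite ler_wpM2r.
    by apply: op_leZ => u; rewrite mul1r.
  by apply: op_leD; apply: op_leN; [exact: HN | exact: op_le_iter_avg].
lra.
Qed.

End OperatorAverage.

Theorem corollary6 (R : realType) (Gamma : groupType) (S : {fset Gamma})
    (Ssym : symmetric_subset S) (Sgen : generates S)
    (SRD : sub_rapid_decay R S) :
  (forall g : Gamma, ~ coamenable R (centralizer g) ->
     forall X : compact_gspace Gamma, minimal X ->
       amenable_nbhd_stabilizers X R -> topologically_free X g) /\
  ((forall g : Gamma, g <> 1%g -> ~ coamenable R (centralizer g)) ->
     cstar_simple R Gamma).
Proof.
split; first exact: (srd_topologically_free Ssym Sgen SRD).
exact: (srd_cstar_simple Ssym Sgen SRD).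
Qed.
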